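(* Let $m>1$, $N\ge2$, and $\chi=C_N$. Let $X_0\in\mathcal R^N$ and let $X$ be the maximal solution in $\mathcal R^N$ of the gradient flow system with $X(0)=X_0$. Then the maximal time of existence of $X$ is $T=+\infty$. Moreover, if $|X(t)|$ is uniformly bounded in $t$, then $Y(t)=X(t)/|X(t)|$ converges as $t\to\infty$ to the unique critical point of $\mathcal F^N_m$ in $\mathcal R^N$ with unit Euclidean norm.
   Context: $\mathcal R^N=\{X\in\mathbb R^N: X_1<\dots<X_N,\ \sum_iX_i=0\}$. $\mathcal F^N_m(X)=\frac1{m-1}\sum_{i=1}^{N-1}(X_{i+1}-X_i)^{1-m}-\frac{\chi}{m-1}\sum_{1\le i\ne j\le N}|X_i-X_j|^{1-m}$. $C_N>0$ is defined by $\frac1{C_N}=\max_{X\in\mathcal R^N}\frac{\sum_{1\le i\ne j\le N}|X_j-X_i|^{1-m}}{\sum_{i=1}^{N-1}(X_{i+1}-X_i)^{1-m}}$. Gradient flow system: for $i=1,\dots,N$, $\dot X_i=-(X_{i+1}-X_i)^{-m}+(X_i-X_{i-1})^{-m}+2\chi\sum_{j\ne i}\mathrm{sign}(j-i)|X_j-X_i|^{-m}$, the first term being absent for $i=N$ and the second for $i=1$ (i.e. $\dot X=-\nabla\mathcal F^N_m(X)$). *)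

(* Defs.v *)
From Stdlib Require Import Reals Lra Lia Arith.
From Coquelicot Require Import Coquelicot.
Open Scope R_scope.

(* Vectors of R^N are functions nat -> R; only indices 0 .. N-1 matter.
   Paper index i (1..N) corresponds to index i-1 here. *)
Definition vec := nat -> R.

Fixpoint rsum (n : nat) (f : nat -> R) : R :=
  match n with
  | O => 0
  | S k => rsum k f + f k
  end.

Definition enorm (N : nat) (X : vec) : R := sqrt (rsum N (fun i => X i ^ 2)).

Definition inRN (N : nat) (X : vec) : Prop :=
  (forall i : nat, (i + 1 < N)%nat -> X i < X (i + 1)%nat) /\ rsum N X = 0.

Definition near_sum (N : nat) (m : R) (X : vec) : R :=
  rsum (N - 1) (fun i => Rpower (X (i + 1)%nat - X i) (1 - m)).

Definition pair_sum (N : nat) (m : R) (X : vec) : R :=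
  rsum N (fun i => rsum N (fun j =>
    if Nat.eqb i j then 0 else Rpower (Rabs (X i - X j)) (1 - m))).

Definition FNm (N : nat) (m chi : R) (X : vec) : R :=
  / (m - 1) * near_sum N m X - chi / (m - 1) * pair_sum N m X.

Definition is_CN (N : nat) (m c : R) : Prop :=
  0 < c /\
  (exists X, inRN N X /\ pair_sum N m X / near_sum N m X = / c) /\
  (forall X, inRN N X -> pair_sum N m X / near_sum N m X <= / c).

Definition sgn_nat (i j : nat) : R :=
  if Nat.ltb i j then 1 else if Nat.ltb j i then -1 else 0.

Definition flow_rhs (N : nat) (m chi : R) (X : vec) (i : nat) : R :=
  (if Nat.ltb (i + 1) N then - Rpower (X (i + 1)%nat - X i) (- m) else 0)
  + (if Nat.ltb 0 i then Rpower (X i - X (i - 1)%nat) (- m) else 0)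
  + 2 * chi * rsum N (fun j =>
      if Nat.eqb j i then 0 else sgn_nat i j * Rpower (Rabs (X j - X i)) (- m)).

Definition is_solution (N : nat) (m chi : R) (X0 : vec) (T : Rbar)
    (X : R -> vec) : Prop :=
  Rbar_lt 0 T /\
  (forall i, (i < N)%nat -> X 0 i = X0 i) /\
  (forall t, 0 <= t -> Rbar_lt t T -> inRN N (X t)) /\
  (forall i, (i < N)%nat ->
     filterlim (fun s => X s i) (at_right 0) (locally (X 0 i))) /\
  (forall t i, 0 < t -> Rbar_lt t T -> (i < N)%nat ->
     is_derive (fun s => X s i) t (flow_rhs N m chi (X t) i)).

Definition is_maximal_solution (N : nat) (m chi : R) (X0 : vec) (T : Rbar)
    (X : R -> vec) : Prop :=
  is_solution N m chi X0 T X /\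
  ~ (exists (T' : Rbar) (X' : R -> vec),
        Rbar_lt T T' /\ is_solution N m chi X0 T' X' /\
        (forall t i, 0 <= t -> Rbar_lt t T -> (i < N)%nat -> X' t i = X t i)).

Definition is_critical (N : nat) (m chi : R) (Y : vec) : Prop :=
  forall i, (i < N)%nat ->
    is_derive (fun s => FNm N m chi (fun k => if Nat.eqb k i then Y k + s else Y k))
              0 0.

(* Main.v *)
Require Import Defs.
From Stdlib Require Import Reals Lra Lia Arith.
From Stdlib Require Import IndefiniteDescription FunctionalExtensionality.
From Coquelicot Require Import Coquelicot.
Open Scope R_scope.

(* Write [phi d = d ^ (1 - m)].  Appending a far particle to a configuration
   strictly raises the ratio of pair energy to gap energy; together with cutting a
   configuration at its largest gap, this gives by induction that clusters of fewer
   than [N] particles are strictly subcritical for [chi = C_N].  Hence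
   [F >= eps * gap energy - C * phi(diameter)].  By Euler's identity
   [d/dt |X|^2 = 2 (m - 1) F(X) >= 0], so the diameter stays bounded below; since [F]
   decreases, all gaps stay bounded below, the velocities are bounded, and the
   solution can be continued past any finite time.  If [|X|] is bounded, the same
   identity forces [F(X(t)) -> 0].  Finally, for a critical [Y] and any [Z], Jensen's
   inequality applied to the ratios of the gaps of [Z] to those of [Y] bounds the
   variance of these ratios by a multiple of [F(Z)]: this yields both uniqueness (take
   [F(Z) = 0]) and convergence of [X / |X|]. *)

(** * Finite sums *)

(** At [chi = C_N] the energy is nonnegative but degenerate: it is homogeneous of degree [1 - m] and
    vanishes on the whole ray through a maximizer of the ratio. A bound on the energy therefore does
    not by itself exclude that all particles collapse to a point, and coercivity can only hold up to
    a power of the diameter.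

    Maximality says only that no extension exists, so global existence requires building one. The
    interaction is frozen at short distances, which makes the field bounded and Lipschitz on the
    whole space without changing it on well-separated configurations; a Picard solution started at
    the limit configuration is then glued on.

    The critical point itself comes from [is_CN], which provides a configuration attaining the
    ratio, hence a zero of the energy and a minimizer. Convergence uses no compactness: the bound by
    the energy is uniform over configurations of bounded diameter. *)

Lemma rsum_ext n f g :
  (forall i, (i < n)%nat -> f i = g i) -> rsum n f = rsum n g.
Proof.
  induction n as [|n IH]; intros H; simpl; auto.
  rewrite IH by (intros; apply H; lia). rewrite H by lia. reflexivity.
Qed.

Lemma rsum_plus n f g : rsum n (fun i => f i + g i) = rsum n f + rsum n g.
Proof. induction n as [|n IH]; simpl; [lra|]. rewrite IH. ring. Qed.

Lemma rsum_minus n f g : rsum n (fun i => f i - g i) = rsum n f - rsum n g.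
Proof. induction n as [|n IH]; simpl; [lra|]. rewrite IH. ring. Qed.

Lemma rsum_scal n c f : rsum n (fun i => c * f i) = c * rsum n f.
Proof. induction n as [|n IH]; simpl; [lra|]. rewrite IH. ring. Qed.

Lemma rsum_const n c : rsum n (fun _ => c) = INR n * c.
Proof.
  induction n as [|n IH]; [simpl; lra|]. rewrite S_INR. simpl rsum. rewrite IH. ring.
Qed.

Lemma rsum_le n f g :
  (forall i, (i < n)%nat -> f i <= g i) -> rsum n f <= rsum n g.
Proof.
  induction n as [|n IH]; intros H; simpl; [lra|].
  pose proof (H n ltac:(lia)). pose proof (IH ltac:(intros; apply H; lia)). lra.
Qed.

Lemma rsum_nonneg n f : (forall i, (i < n)%nat -> 0 <= f i) -> 0 <= rsum n f.
Proof.
  intros H. rewrite <- (Rmult_0_r (INR n)), <- rsum_const. now apply rsum_le.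
Qed.

Lemma rsum_term_le n f k :
  (forall i, (i < n)%nat -> 0 <= f i) -> (k < n)%nat -> f k <= rsum n f.
Proof.
  induction n as [|n IH]; intros H Hk; [lia|]. simpl.
  destruct (Nat.eq_dec k n) as [->|Hne].
  - pose proof (rsum_nonneg n f ltac:(intros; apply H; lia)). lra.
  - pose proof (IH ltac:(intros; apply H; lia) ltac:(lia)).
    pose proof (H n ltac:(lia)). lra.
Qed.

Lemma rsum_add a b f : rsum (a + b) f = rsum a f + rsum b (fun i => f (a + i)%nat).
Proof.
  induction b as [|b IH]; [rewrite Nat.add_0_r; simpl; ring|].
  rewrite Nat.add_succ_r. simpl. rewrite IH. ring.
Qed.

Lemma rsum_telescope l u i :
  rsum l (fun k => u (i + k + 1)%nat - u (i + k)%nat) = u (i + l)%nat - u i.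
Proof.
  induction l as [|l IH]; simpl; [rewrite Nat.add_0_r; ring|].
  rewrite IH. replace (i + l + 1)%nat with (i + S l)%nat by lia. ring.
Qed.

Lemma rsum_Rabs n f : Rabs (rsum n f) <= rsum n (fun i => Rabs (f i)).
Proof.
  induction n as [|n IH]; simpl; [rewrite Rabs_R0; lra|].
  pose proof (Rabs_triang (rsum n f) (f n)). lra.
Qed.

Lemma rsum_derive n (f : nat -> R -> R) df t :
  (forall i, (i < n)%nat -> is_derive (f i) t (df i)) ->
  is_derive (fun s => rsum n (fun i => f i s)) t (rsum n df).
Proof.
  induction n as [|n IH]; intros H; simpl.
  - apply (is_derive_const (K := R_AbsRing) (V := R_NormedModule)).
  - apply (is_derive_plus (K := R_AbsRing) (V := R_NormedModule)
             (fun s => rsum n (fun i => f i s)) (f n)).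
    + apply IH; intros; apply H; lia.
    + apply H; lia.
Qed.

(** Each unordered pair is counted once, with the larger index last, so that for ordered
    configurations [X j - X i] is positive and absolute values disappear. *)
Definition tri (n : nat) (h : nat -> nat -> R) : R :=
  rsum n (fun j => rsum j (fun i => h i j)).

Lemma tri_ext n h g :
  (forall i j, (i < j)%nat -> (j < n)%nat -> h i j = g i j) -> tri n h = tri n g.
Proof. intros H. apply rsum_ext; intros j Hj. apply rsum_ext; intros; now apply H. Qed.

Lemma tri_minus n h g : tri n (fun i j => h i j - g i j) = tri n h - tri n g.
Proof.
  unfold tri. rewrite <- rsum_minus. apply rsum_ext; intros. apply rsum_minus.
Qed.

Lemma tri_scal n c h : tri n (fun i j => c * h i j) = c * tri n h.
Proof.
  unfold tri. rewrite <- rsum_scal. apply rsum_ext; intros. apply rsum_scal.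
Qed.

Lemma tri_term_le n h a b :
  (forall i j, (i < j)%nat -> (j < n)%nat -> 0 <= h i j) ->
  (a < b)%nat -> (b < n)%nat -> h a b <= tri n h.
Proof.
  intros H Hab Hb. unfold tri.
  apply Rle_trans with (rsum b (fun i => h i b)).
  - apply (rsum_term_le b (fun i => h i b)); auto.
  - apply (rsum_term_le n (fun j => rsum j (fun i => h i j))); auto.
    intros; apply rsum_nonneg; auto.
Qed.

Lemma tri_add s t h :
  tri (s + t) h = tri s h + tri t (fun i j => h (s + i)%nat (s + j)%nat)
                  + rsum t (fun j => rsum s (fun i => h i (s + j)%nat)).
Proof.
  induction t as [|t IH]; [rewrite Nat.add_0_r; unfold tri; simpl; ring|].
  rewrite Nat.add_succ_r. unfold tri in *. simpl.
  rewrite IH, rsum_add. ring.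
Qed.

Lemma double_sum_sym n h :
  (forall i j, h i j = h j i) ->
  rsum n (fun i => rsum n (fun j => if Nat.eqb i j then 0 else h i j)) = 2 * tri n h.
Proof.
  intros Hs. induction n as [|n IH]; [unfold tri; simpl; ring|].
  unfold tri in *. simpl. rewrite rsum_plus, IH, Nat.eqb_refl.
  rewrite (rsum_ext n (fun i => if Nat.eqb i n then 0 else h i n) (fun i => h i n)).
  2:{ intros i Hi. destruct (Nat.eqb_spec i n); [lia|auto]. }
  rewrite (rsum_ext n (fun j => if Nat.eqb n j then 0 else h n j) (fun i => h i n)).
  2:{ intros i Hi. destruct (Nat.eqb_spec n i); [lia|auto]. }
  ring.
Qed.

(** Two particles exert opposite forces on each other, so the two terms of a pair merge into one
    multiple of [v j - v i]. The induction on [n] adds the row and the column of the last index. *)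
Lemma double_sum_antisym n q v :
  (forall i j, q i j = q j i) ->
  rsum n (fun i => v i *
    rsum n (fun j => if Nat.eqb j i then 0 else sgn_nat i j * q j i))
  = - tri n (fun i j => q i j * (v j - v i)).
Proof.
  intros Hs. induction n as [|n IH]; [unfold tri; simpl; ring|].
  unfold tri in *. simpl. rewrite Nat.eqb_refl.
  rewrite (rsum_ext n _ (fun i => v i *
    rsum n (fun j => if Nat.eqb j i then 0 else sgn_nat i j * q j i) + q i n * v i)).
  2:{ intros i Hi. unfold sgn_nat. destruct (Nat.eqb_spec n i); [lia|].
      destruct (Nat.ltb_spec i n); [|lia]. rewrite (Hs n i). ring. }
  rewrite rsum_plus, IH.
  rewrite (rsum_ext n (fun j => if Nat.eqb j n then 0 else sgn_nat n j * q j n)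
             (fun j => (-1) * q j n)).
  2:{ intros i Hi. unfold sgn_nat. destruct (Nat.eqb_spec i n); [lia|].
      destruct (Nat.ltb_spec n i); [lia|]. destruct (Nat.ltb_spec i n); [auto|lia]. }
  rewrite (rsum_ext n (fun i => q i n * (v n - v i)) (fun i => v n * q i n - q i n * v i)).
  2:{ intros; ring. }
  rewrite rsum_minus, !rsum_scal. ring.
Qed.

(** * Powers and elementary calculus *)

Lemma Rpower_decr z a b : z <= 0 -> 0 < a <= b -> Rpower b z <= Rpower a z.
Proof.
  intros Hz [Ha Hab]. unfold Rpower.
  assert (ln a <= ln b) by (apply ln_le; auto).
  destruct (Rle_lt_or_eq_dec (z * ln b) (z * ln a)) as [H1|H1]; [nra| |].
  - left. now apply exp_increasing.
  - rewrite H1. lra.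
Qed.

Lemma Rpower_gt0 x z : 0 < Rpower x z.
Proof. apply exp_pos. Qed.

Lemma Rpower_derive z x : 0 < x -> is_derive (fun y => Rpower y z) x (z * Rpower x (z - 1)).
Proof. intros Hx. apply is_derive_Reals. now apply derivable_pt_lim_power. Qed.

Lemma Rpower_pred x m : 0 < x -> Rpower x (1 - m) = Rpower x (- m) * x.
Proof.
  intros Hx. rewrite <- (Rpower_1 x) at 3 by auto. rewrite <- Rpower_plus. f_equal. ring.
Qed.

Lemma mvt f df a b : a <= b ->
  (forall x, a <= x <= b -> is_derive f x (df x)) ->
  exists c, a <= c <= b /\ f b - f a = df c * (b - a).
Proof.
  intros Hab H.
  destruct (MVT_gen f a b df) as [c [Hc1 Hc2]].
  - intros x Hx. apply H. rewrite Rmin_left, Rmax_right in Hx; lra.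
  - intros x Hx. rewrite Rmin_left, Rmax_right in Hx by lra.
    apply derivable_continuous_pt. exists (df x). apply is_derive_Reals, H. lra.
  - rewrite Rmin_left, Rmax_right in Hc1 by lra. eauto.
Qed.

(** For functions with no usable formula: it differentiates the limit of the Picard iterates, and
    the glued solution at the gluing time. *)
Lemma is_derive_of_quadratic f s l C eta : 0 < eta ->
  (forall t, Rabs (t - s) < eta -> Rabs (f t - f s - (t - s) * l) <= C * (t - s) ^ 2) ->
  is_derive f s l.
Proof.
  intros Heta H. apply is_derive_Reals. intros eps Heps.
  set (d := Rmin eta (eps / (Rabs C + 1))).
  assert (HC : 0 < Rabs C + 1) by (pose proof (Rabs_pos C); lra).
  assert (Hd : 0 < d) by (apply Rmin_glb_lt; auto; now apply Rdiv_lt_0_compat).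
  exists (mkposreal d Hd). simpl. intros h Hh Hhd.
  assert (H1 : Rabs h < eta) by (eapply Rlt_le_trans; [apply Hhd|apply Rmin_l]).
  assert (H2 : Rabs h < eps / (Rabs C + 1)) by (eapply Rlt_le_trans; [apply Hhd|apply Rmin_r]).
  specialize (H (s + h)). replace (s + h - s) with h in H by ring. specialize (H H1).
  assert (Hp : 0 < Rabs h) by now apply Rabs_pos_lt.
  replace ((f (s + h) - f s) / h - l) with ((f (s + h) - f s - h * l) / h) by (field; auto).
  unfold Rdiv. rewrite Rabs_mult, Rabs_inv.
  apply Rmult_lt_reg_r with (Rabs h); auto.
  rewrite Rmult_assoc, Rinv_l, Rmult_1_r by lra.
  eapply Rle_lt_trans; [apply H|].
  rewrite <- (pow2_abs h).
  pose proof (Rle_abs C).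
  assert (Rabs h * (Rabs C + 1) < eps).
  { apply Rmult_lt_compat_r with (r := Rabs C + 1) in H2; auto.
    unfold Rdiv in H2. rewrite Rmult_assoc, Rinv_l, Rmult_1_r in H2; lra. }
  nra.
Qed.

(* Strong convexity of [x ^ (1 - m)] on [(0, L]], in tangent form. *)
Lemma Rpower_tangent m L a x : 1 < m -> 0 < a <= L -> 0 < x <= L ->
  Rpower a (1 - m) - (m - 1) * Rpower a (- m) * (x - a)
    + m * (m - 1) / 2 * Rpower L (- m - 1) * (x - a) ^ 2 <= Rpower x (1 - m).
Proof.
  intros Hm Ha Hx.
  set (k := m * (m - 1) / 2 * Rpower L (- m - 1)).
  (* [2 * k] is the second derivative of [x ^ (1 - m)] at [L], the smallest one on [(0, L]]; hence
     subtracting [k * x ^ 2] leaves a nondecreasing derivative. *)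
  assert (Hmono : forall u v, 0 < u -> u <= v -> v <= L ->
     (1 - m) * Rpower u (- m) - 2 * k * u <= (1 - m) * Rpower v (- m) - 2 * k * v).
  { intros u v Hu Huv Hv.
    destruct (mvt (fun y => (1 - m) * Rpower y (- m) - 2 * k * y)
      (fun y => (1 - m) * (- m * Rpower y (- m - 1)) - 2 * k) u v Huv) as [c [Hc E]].
    { intros y Hy.
      apply (is_derive_minus (K := R_AbsRing) (V := R_NormedModule)
               (fun y => (1 - m) * Rpower y (- m)) (fun y => 2 * k * y)).
      - apply is_derive_scal, Rpower_derive. lra.
      - auto_derive; auto; ring. }
    cut (0 <= (1 - m) * (- m * Rpower c (- m - 1)) - 2 * k); [intros; nra|].
    unfold k. pose proof (Rpower_decr (- m - 1) c L ltac:(lra) ltac:(lra)).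
    replace ((1 - m) * (- m * Rpower c (- m - 1)) - 2 * (m * (m - 1) / 2 * Rpower L (- m - 1)))
      with (m * (m - 1) * (Rpower c (- m - 1) - Rpower L (- m - 1))) by field.
    apply Rmult_le_pos; nra. }
  assert (Hder : forall y, 0 < y ->
     is_derive (fun y => Rpower y (1 - m) - k * y ^ 2) y ((1 - m) * Rpower y (- m) - 2 * k * y)).
  { intros y Hy.
    apply (is_derive_minus (K := R_AbsRing) (V := R_NormedModule)
             (fun y => Rpower y (1 - m)) (fun y => k * y ^ 2)).
    - replace (- m) with (1 - m - 1) by ring. now apply Rpower_derive.
    - auto_derive; auto; ring. }
  destruct (Rle_dec a x) as [Hax|Hax].
  - destruct (mvt _ _ a x Hax (fun y Hy => Hder y ltac:(lra))) as [c [Hc E]].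
    simpl in E. pose proof (Hmono a c ltac:(lra) ltac:(lra) ltac:(lra)). nra.
  - destruct (mvt _ _ x a ltac:(lra) (fun y Hy => Hder y ltac:(lra))) as [c [Hc E]].
    simpl in E. pose proof (Hmono c a ltac:(lra) ltac:(lra) ltac:(lra)). nra.
Qed.

(** * Coercivity of the energy *)

(* [n] counts gaps: the configuration has the [n + 1] particles [X 0, ..., X n]. *)
Definition ordered (n : nat) (X : vec) : Prop :=
  forall i : nat, (i < n)%nat -> X i < X (i + 1)%nat.

Definition gap_energy (n : nat) (m : R) (X : vec) : R :=
  rsum n (fun k => Rpower (X (k + 1)%nat - X k) (1 - m)).

Definition tri_energy (n : nat) (m : R) (X : vec) : R :=
  tri (S n) (fun i j => Rpower (X j - X i) (1 - m)).

(** The factor 2 accounts for the ordered pairs in [pair_sum]. With [r = / chi] the bound says that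
    [energy] is nonnegative. No centering is required, because the clusters cut out of a
    configuration are not centered. *)
Definition ratio_bound (m : R) (n : nat) (r : R) : Prop :=
  forall X, ordered n X -> 2 * tri_energy n m X <= r * gap_energy n m X.

Lemma ordered_lt n X i j : ordered n X -> (i < j <= n)%nat -> X i < X j.
Proof.
  intros H [Hij Hj]. induction j as [|j IH]; [lia|].
  pose proof (H j ltac:(lia)). rewrite Nat.add_1_r in H0.
  destruct (Nat.eq_dec i j) as [->|]; [auto|].
  pose proof (IH ltac:(lia) ltac:(lia)). lra.
Qed.

Lemma ordered_le n X i j : ordered n X -> (i <= j <= n)%nat -> X i <= X j.
Proof.
  intros H Hij. destruct (Nat.eq_dec i j) as [->|]; [lra|].
  left. apply (ordered_lt n); auto; lia.
Qed.

Lemma gap_energy_nonneg n m X : 0 <= gap_energy n m X.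
Proof. apply rsum_nonneg; intros; left; apply Rpower_gt0. Qed.

(** Any pair is at least as far apart as the gap just to the right of its left member, so each new
    particle costs at most one full gap energy. The bound is crude, but suffices when [r] is
    large. *)
Lemma ratio_bound_trivial m n : 1 < m -> ratio_bound m n (2 * INR n).
Proof.
  intros Hm X. unfold tri_energy, gap_energy. induction n as [|n IH]; intros H.
  - unfold tri; simpl; lra.
  - rewrite S_INR. assert (Hn : ordered n X) by (intros i Hi; apply H; lia).
    specialize (IH Hn). unfold tri in *.
    set (T := rsum (S n) (fun j => rsum j (fun i => Rpower (X j - X i) (1 - m)))) in *.
    change (2 * (T + rsum (S n) (fun i => Rpower (X (S n) - X i) (1 - m))) <=
      2 * (INR n + 1) * rsum (S n) (fun k => Rpower (X (k + 1)%nat - X k) (1 - m))).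
    assert (H1 : rsum (S n) (fun i => Rpower (X (S n) - X i) (1 - m)) <=
      rsum (S n) (fun k => Rpower (X (k + 1)%nat - X k) (1 - m))).
    { apply rsum_le; intros i Hi. apply Rpower_decr; [lra|].
      pose proof (H i Hi). pose proof (ordered_le _ _ (i + 1) (S n) H ltac:(lia)). lra. }
    assert (H2 : rsum n (fun k => Rpower (X (k + 1)%nat - X k) (1 - m)) <=
      rsum (S n) (fun k => Rpower (X (k + 1)%nat - X k) (1 - m))).
    { simpl. pose proof (Rpower_gt0 (X (n + 1)%nat - X n) (1 - m)). lra. }
    pose proof (Rmult_le_compat_l (INR n) _ _ (pos_INR n) H2). lra.
Qed.

Lemma ratio_bound_weaken m n r r' : r <= r' -> ratio_bound m n r -> ratio_bound m n r'.
Proof.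
  intros Hr H X HX. pose proof (H X HX). pose proof (gap_energy_nonneg n m X). nra.
Qed.

Lemma Rpower_one_plus_ge m u : 1 < m -> 0 < u -> 1 - (m - 1) * u <= Rpower (1 + u) (1 - m).
Proof.
  intros Hm Hu. unfold Rpower.
  assert (ln (1 + u) <= u).
  { pose proof (exp_ineq1_le u). rewrite <- (ln_exp u) at 2. apply ln_le; lra. }
  pose proof (exp_ineq1_le ((1 - m) * ln (1 + u))). nra.
Qed.

(* Appending one far particle, at distance [A] times the diameter, raises the
   ratio of the two energies. *)
Lemma far_particle m n r : 1 < m -> ratio_bound m (S n) r -> r < 2 * INR n + 1 ->
  exists c, 0 < c /\ forall X, ordered n X -> X 0%nat < X n ->
    c * Rpower (X n - X 0%nat) (1 - m) <= r * gap_energy n m X - 2 * tri_energy n m X.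
Proof.
  (* With this [A], Bernoulli gives [2 (n + 1) (1 + 1 / A) ^ (1 - m) >= 2 n + 1]: the new particle,
     within [(A + 1) D] of all others, raises [2 * tri_energy] by more than [r] times the one gap
     term it creates. The excess is [2 n + 1 - r]. *)
  intros Hm Hb Hr. set (A := 2 * (INR n + 1) * (m - 1)).
  pose proof (pos_INR n) as Hn.
  assert (HA : 0 < A) by (unfold A; nra).
  exists (Rpower A (1 - m) * (2 * INR n + 1 - r)). split.
  { apply Rmult_lt_0_compat; [apply Rpower_gt0|lra]. }
  intros X HX HD. set (D := X n - X 0%nat). assert (0 < D) by (unfold D; lra).
  set (Z := fun i => if Nat.leb i n then X i else X n + A * D).
  assert (HZn : forall i, (i <= n)%nat -> Z i = X i).
  { intros i Hi. unfold Z. destruct (Nat.leb_spec i n); [auto|lia]. }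
  assert (HZS : Z (S n) = X n + A * D).
  { unfold Z. destruct (Nat.leb_spec (S n) n); [lia|auto]. }
  assert (HZ : ordered (S n) Z).
  { intros i Hi. destruct (Nat.eq_dec i n) as [->|].
    - rewrite Nat.add_1_r, HZS, HZn by lia. nra.
    - rewrite !HZn by lia. apply HX. lia. }
  specialize (Hb Z HZ). unfold tri_energy, gap_energy in *.
  change (2 * (tri (S n) (fun i j => Rpower (Z j - Z i) (1 - m))
            + rsum (S n) (fun i => Rpower (Z (S n) - Z i) (1 - m)))
    <= r * (rsum n (fun k => Rpower (Z (k + 1)%nat - Z k) (1 - m))
            + Rpower (Z (n + 1)%nat - Z n) (1 - m))) in Hb.
  rewrite (tri_ext (S n) _ (fun i j => Rpower (X j - X i) (1 - m))) in Hb
    by (intros; rewrite !HZn by lia; auto).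
  rewrite (rsum_ext n _ (fun k => Rpower (X (k + 1)%nat - X k) (1 - m))) in Hb
    by (intros; rewrite !HZn by lia; auto).
  rewrite Nat.add_1_r, HZS, HZn in Hb by lia.
  replace (X n + A * D - X n) with (A * D) in Hb by ring.
  rewrite <- Rpower_mult_distr in Hb by auto.
  assert (H1 : INR (S n) * (Rpower A (1 - m) * Rpower D (1 - m) * Rpower (1 + / A) (1 - m)) <=
     rsum (S n) (fun i => Rpower (X n + A * D - Z i) (1 - m))).
  { rewrite <- rsum_const. apply rsum_le. intros i Hi. rewrite HZn by lia.
    rewrite !Rpower_mult_distr; auto; try nra.
    2:{ pose proof (Rinv_0_lt_compat A HA). lra. }
    apply Rpower_decr; [lra|].
    pose proof (ordered_le n X 0 i HX ltac:(lia)).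
    pose proof (ordered_le n X i n HX ltac:(lia)).
    replace (A * D * (1 + / A)) with (A * D + D) by (field; lra).
    unfold D in *. nra. }
  rewrite S_INR in H1.
  pose proof (Rpower_one_plus_ge m (/ A) Hm (Rinv_0_lt_compat A HA)) as H2.
  assert (H3 : 2 * INR n + 1 <= 2 * ((INR n + 1) * Rpower (1 + / A) (1 - m))).
  { assert ((INR n + 1) * ((m - 1) * / A) = / 2) by (unfold A; field; lra). nra. }
  set (P := Rpower A (1 - m)) in *. set (Q := Rpower D (1 - m)) in *.
  assert (0 < P * Q) by (apply Rmult_lt_0_compat; apply Rpower_gt0).
  pose proof (Rmult_le_compat_l _ _ _ (Rlt_le _ _ H0) H3). nra.
Qed.

Lemma large_gap n X : ordered n X -> (0 < n)%nat ->
  exists a, (a < n)%nat /\ X n - X 0%nat <= INR n * (X (a + 1)%nat - X a).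
Proof.
  intros HX Hn. destruct (Classical_Prop.classic
    (exists a, (a < n)%nat /\ X n - X 0%nat <= INR n * (X (a + 1)%nat - X a))) as [H|H]; auto.
  exfalso. assert (Hlt : 0 < INR n) by (apply lt_0_INR; lia).
  assert (Hs : forall k, (k < n)%nat ->
     rsum (S k) (fun i => X (0 + i + 1)%nat - X (0 + i)%nat) < INR (S k) * ((X n - X 0%nat) / INR n)).
  { intros k Hk. assert (Hg : forall i, (i < n)%nat -> X (i + 1)%nat - X i < (X n - X 0%nat) / INR n).
    { intros i Hi. apply Rnot_le_lt. intros Hle. apply H. exists i. split; auto.
      apply (Rmult_le_compat_l (INR n)) in Hle; [|lra].
      unfold Rdiv in Hle. rewrite (Rmult_comm _ (/ INR n)), <- Rmult_assoc, Rinv_r, Rmult_1_l in Hle; lra. }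
    induction k as [|k IH].
    - simpl. pose proof (Hg 0%nat ltac:(lia)). simpl in *. lra.
    - rewrite S_INR. specialize (IH ltac:(lia)). pose proof (Hg (S k) Hk).
      change (rsum (S k) (fun i => X (0 + i + 1)%nat - X (0 + i)%nat) + (X (S k + 1)%nat - X (S k)) <
        (INR (S k) + 1) * ((X n - X 0%nat) / INR n)). lra. }
  specialize (Hs (n - 1)%nat ltac:(lia)). replace (S (n - 1)) with n in Hs by lia.
  rewrite (rsum_telescope n X 0) in Hs. simpl (0 + n)%nat in Hs.
  replace (INR n * ((X n - X 0%nat) / INR n)) with (X n - X 0%nat) in Hs by (field; lra). lra.
Qed.

(* Cutting at the largest gap leaves two smaller clusters, to which the strict
   bound applies; all cross terms are controlled by that gap. *)
Lemma split_at_gap m n r eps : 1 < m -> 0 < eps ->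
  (forall k, (k < n)%nat -> ratio_bound m k (r - eps)) ->
  exists C, 0 < C /\ forall X, ordered n X -> X 0%nat < X n ->
    eps * gap_energy n m X - C * Rpower (X n - X 0%nat) (1 - m)
      <= r * gap_energy n m X - 2 * tri_energy n m X.
Proof.
  intros Hm He Hk.
  destruct (Nat.eq_dec n 0) as [->|Hn0].
  { exists 1. split; [lra|]. intros; lra. }
  assert (HnR : 0 < INR n) by (apply lt_0_INR; lia).
  (* The cut gap is at least [1 / n] of the diameter, whence the power of [/ INR n]. The term
     [2 (n + 1) ^ 2] allows for the cross pairs, and [Rabs (r - eps)] for the cut gap itself, as
     [r - eps] may have either sign. *)
  exists ((Rabs (r - eps) + 2 * (INR (S n) * INR (S n))) * Rpower (/ INR n) (1 - m)).
  split.
  { apply Rmult_lt_0_compat; [|apply Rpower_gt0]. pose proof (Rabs_pos (r - eps)).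
    rewrite S_INR. nra. }
  intros X HX HD. destruct (large_gap n X HX ltac:(lia)) as [a [Ha Hg]].
  set (D := X n - X 0%nat) in *. set (g := X (a + 1)%nat - X a) in *.
  (* Gap [a] leaves the particles [0..a] and [S a..n], with [a] and [b] gaps, both fewer than
     [n]. *)
  set (b := (n - a - 1)%nat). assert (Hn : (n = a + S b)%nat) by (unfold b; lia).
  set (Z := fun i => X (S a + i)%nat).
  assert (HA : ordered a X) by (intros i Hi; apply HX; lia).
  assert (HB : ordered b Z).
  { intros i Hi. unfold Z. replace (S a + (i + 1))%nat with (S a + i + 1)%nat by lia.
    apply HX; lia. }
  pose proof (Hk a ltac:(lia) X HA) as H1. pose proof (Hk b ltac:(lia) Z HB) as H2.
  assert (Hphi : Rpower g (1 - m) <= Rpower (/ INR n) (1 - m) * Rpower D (1 - m)).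
  { assert (0 < / INR n) by now apply Rinv_0_lt_compat.
    assert (0 < D) by (unfold D; lra).
    rewrite Rpower_mult_distr by auto. apply Rpower_decr; [lra|]. split; [nra|].
    apply Rmult_le_reg_l with (INR n); auto.
    rewrite <- Rmult_assoc, Rinv_r, Rmult_1_l; lra. }
  assert (HE : gap_energy n m X = gap_energy a m X + Rpower g (1 - m) + gap_energy b m Z).
  { unfold gap_energy, g. rewrite Hn at 1. rewrite rsum_add.
    change (S b) with (1 + b)%nat. rewrite (rsum_add 1 b). simpl.
    rewrite Nat.add_0_r, Rplus_0_l. rewrite Rplus_assoc. do 2 f_equal.
    apply rsum_ext; intros i Hi. unfold Z. do 2 f_equal; f_equal; lia. }
  assert (HT : tri_energy n m X <= tri_energy a m X + tri_energy b m Z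
             + INR (S n) * INR (S n) * Rpower g (1 - m)).
  { unfold tri_energy. replace (S n) with (S a + S b)%nat at 1 by lia. rewrite tri_add.
    apply Rplus_le_compat.
    { right. reflexivity. }
    apply Rle_trans with (rsum (S b) (fun j => rsum (S a) (fun i => Rpower g (1 - m)))).
    - apply rsum_le; intros j Hj. apply rsum_le; intros i Hi. apply Rpower_decr; [lra|].
      pose proof (HX a Ha). unfold g. split; [lra|].
      pose proof (ordered_le n X i a HX ltac:(lia)).
      pose proof (ordered_le n X (a + 1) (S a + j) HX ltac:(lia)). lra.
    - rewrite !rsum_const. rewrite <- Rmult_assoc.
      apply Rmult_le_compat_r; [left; apply Rpower_gt0|].
      apply Rmult_le_compat; try apply pos_INR; apply le_INR; lia. }
  pose proof (Rpower_gt0 g (1 - m)).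
  set (K := INR (S n) * INR (S n)) in *.
  assert (0 <= K) by (unfold K; pose proof (pos_INR (S n)); nra).
  assert (H4 : (Rabs (r - eps) + 2 * K) * Rpower g (1 - m) <=
     (Rabs (r - eps) + 2 * K) * (Rpower (/ INR n) (1 - m) * Rpower D (1 - m))).
  { apply Rmult_le_compat_l; auto. pose proof (Rabs_pos (r - eps)). lra. }
  assert (H5 : - Rabs (r - eps) * Rpower g (1 - m) <= (r - eps) * Rpower g (1 - m)).
  { apply Rmult_le_compat_r; [lra|]. unfold Rabs. destruct (Rcase_abs (r - eps)); lra. }
  rewrite HE. nra.
Qed.

Lemma ratio_bound_step m n r : 1 < m -> ratio_bound m (S n) r ->
  exists eps, 0 < eps /\ forall k, (k <= n)%nat -> ratio_bound m k (r - eps).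
Proof.
  intros Hm. revert r. induction n as [|n IH]; intros r Hb.
  { exists 1. split; [lra|]. intros k Hk X HX. replace k with 0%nat by lia.
    unfold tri_energy, gap_energy, tri; simpl; lra. }
  (* From this threshold on, the trivial bound already leaves a margin of 1. Below it the far
     particle applies, and it also passes the bound [r] down to [S n] gaps for the induction
     hypothesis. *)
  destruct (Rlt_le_dec r (2 * INR (S n) + 1)) as [Hr|Hr].
  - destruct (far_particle m (S n) r Hm Hb Hr) as [c [Hc Hfar]].
    assert (HSn : forall X, ordered (S n) X -> X 0%nat < X (S n)).
    { intros X HX. apply (ordered_lt (S n)); auto; lia. }
    assert (Hb' : ratio_bound m (S n) r).
    { intros X HX. specialize (Hfar X HX (HSn X HX)).
      pose proof (Rpower_gt0 (X (S n) - X 0%nat) (1 - m)). nra. }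
    destruct (IH r Hb') as [e [He Hk]].
    destruct (split_at_gap m (S n) r e Hm He) as [C [HC Hsp]].
    { intros k Hkn. apply Hk. lia. }
    (* [C] times the far-particle estimate plus [c] times the splitting estimate cancels the powers
       of the diameter and leaves the margin [c * e / (c + C)]. *)
    exists (Rmin e (c * e / (c + C))).
    assert (0 < c * e / (c + C)) by (apply Rdiv_lt_0_compat; nra).
    split; [now apply Rmin_glb_lt|]. intros k Hkn.
    destruct (Nat.eq_dec k (S n)) as [->|].
    + apply ratio_bound_weaken with (r - c * e / (c + C)).
      { pose proof (Rmin_r e (c * e / (c + C))). lra. }
      intros X HX. specialize (Hfar X HX (HSn X HX)). specialize (Hsp X HX (HSn X HX)).
      set (G := gap_energy (S n) m X) in *. set (T := tri_energy (S n) m X) in *.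
      set (P := Rpower (X (S n) - X 0%nat) (1 - m)) in *.
      apply Rmult_le_reg_l with (c + C); [lra|].
      replace ((c + C) * ((r - c * e / (c + C)) * G)) with ((c + C) * r * G - c * e * G)
        by (field; lra).
      pose proof (Rmult_le_compat_l C _ _ (Rlt_le _ _ HC) Hfar).
      pose proof (Rmult_le_compat_l c _ _ (Rlt_le _ _ Hc) Hsp). nra.
    + apply ratio_bound_weaken with (r - e); [|apply Hk; lia].
      pose proof (Rmin_l e (c * e / (c + C))). lra.
  - exists 1. split; [lra|]. intros k Hk.
    apply ratio_bound_weaken with (2 * INR k); [|now apply ratio_bound_trivial].
    apply le_INR in Hk. lra.
Qed.

(** The full configuration may be critical, but a cut leaves two strictly subcritical clusters; what
    is lost is controlled by the cut gap, hence by a power of the diameter. *)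
Lemma coercivity m n r : 1 < m -> ratio_bound m (S n) r ->
  exists eps C, 0 < eps /\ 0 < C /\ forall X, ordered (S n) X ->
    eps * gap_energy (S n) m X - C * Rpower (X (S n) - X 0%nat) (1 - m)
      <= r * gap_energy (S n) m X - 2 * tri_energy (S n) m X.
Proof.
  intros Hm Hb. destruct (ratio_bound_step m n r Hm Hb) as [e [He Hk]].
  destruct (split_at_gap m (S n) r e Hm He) as [C [HC H]].
  { intros k Hkn. apply Hk. lia. }
  exists e, C. repeat split; auto. intros X HX. apply H; auto.
  apply (ordered_lt (S n)); auto; lia.
Qed.

(** * The energy and its gradient *)

(* [flow_rhs] with an arbitrary interaction law [p]; [flow_rhs] itself is the
   case [p d = d ^ (- m)]. *)
Definition flow_with (p : R -> R) (N : nat) (chi : R) (X : vec) (i : nat) : R :=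
  (if Nat.ltb (i + 1) N then - p (X (i + 1)%nat - X i) else 0)
  + (if Nat.ltb 0 i then p (X i - X (i - 1)%nat) else 0)
  + 2 * chi * rsum N (fun j =>
      if Nat.eqb j i then 0 else sgn_nat i j * p (Rabs (X j - X i))).

(** Weak form of the gradient. Testing with [X] gives Euler's identity, with a constant the
    conservation of the center of mass, with a velocity the derivative of the energy;
    [energy_defect] uses one more test vector. The absolute values stay since nothing is assumed on
    the order of [X]. *)
Lemma flow_with_sum_by_parts p n chi X v :
  rsum (S n) (fun i => v i * flow_with p (S n) chi X i)
  = rsum n (fun k => p (X (k + 1)%nat - X k) * (v (k + 1)%nat - v k))
    - 2 * chi * tri (S n) (fun i j => p (Rabs (X j - X i)) * (v j - v i)).
Proof.
  pose proof (double_sum_antisym (S n) (fun j i => p (Rabs (X j - X i))) v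
    (fun a b => f_equal p (Rabs_minus_sym (X a) (X b)))) as H. cbv beta in H.
  rewrite (tri_ext (S n) (fun i j => p (Rabs (X j - X i)) * (v j - v i))
    (fun i j => p (Rabs (X i - X j)) * (v j - v i)))
    by (intros i j _ _; now rewrite (Rabs_minus_sym (X i))).
  rewrite <- (Ropp_involutive (tri _ _)), <- H.
  unfold flow_with.
  rewrite (rsum_ext (S n) _ (fun i =>
     (v i * (if Nat.ltb (i + 1) (S n) then - p (X (i + 1)%nat - X i) else 0)
      + v i * (if Nat.ltb 0 i then p (X i - X (i - 1)%nat) else 0))
     + (2 * chi) * (v i * rsum (S n) (fun j =>
        if Nat.eqb j i then 0 else sgn_nat i j * p (Rabs (X j - X i)))))) by (intros; ring).
  rewrite rsum_plus, rsum_scal, rsum_plus.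
  set (Q := rsum (S n) (fun i => v i * rsum (S n) _)).
  assert (H1 : rsum (S n) (fun i => v i * (if Nat.ltb (i + 1) (S n)
      then - p (X (i + 1)%nat - X i) else 0))
    = rsum n (fun k => (-1) * (p (X (k + 1)%nat - X k) * v k))).
  { change (rsum n (fun i => v i * (if Nat.ltb (i + 1) (S n)
      then - p (X (i + 1)%nat - X i) else 0)) + v n * (if Nat.ltb (n + 1) (S n)
      then - p (X (n + 1)%nat - X n) else 0) =
      rsum n (fun k => (-1) * (p (X (k + 1)%nat - X k) * v k))).
    destruct (Nat.ltb_spec (n + 1) (S n)); [lia|]. rewrite Rmult_0_r, Rplus_0_r.
    apply rsum_ext; intros i Hi. destruct (Nat.ltb_spec (i + 1) (S n)); [ring|lia]. }
  assert (H2 : rsum (S n) (fun i => v i * (if Nat.ltb 0 i then p (X i - X (i - 1)%nat) else 0))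
    = rsum n (fun k => p (X (k + 1)%nat - X k) * v (k + 1)%nat)).
  { change (S n) with (1 + n)%nat. rewrite rsum_add. simpl rsum at 1.
    rewrite Rmult_0_r, !Rplus_0_l. apply rsum_ext; intros i Hi.
    destruct (Nat.ltb_spec 0 (1 + i)); [|lia].
    replace (1 + i - 1)%nat with i by lia. rewrite (Nat.add_comm 1 i). ring. }
  rewrite H1, H2, rsum_scal.
  rewrite (rsum_ext n (fun k => p (X (k + 1)%nat - X k) * (v (k + 1)%nat - v k))
    (fun k => p (X (k + 1)%nat - X k) * v (k + 1)%nat - p (X (k + 1)%nat - X k) * v k))
    by (intros; ring).
  rewrite rsum_minus. ring.
Qed.

Lemma flow_sum_by_parts n m chi X v : ordered n X ->
  rsum (S n) (fun i => v i * flow_rhs (S n) m chi X i)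
  = rsum n (fun k => Rpower (X (k + 1)%nat - X k) (- m) * (v (k + 1)%nat - v k))
    - 2 * chi * tri (S n) (fun i j => Rpower (X j - X i) (- m) * (v j - v i)).
Proof.
  intros HX.
  change (flow_rhs (S n) m chi X) with (flow_with (fun d => Rpower d (- m)) (S n) chi X).
  rewrite flow_with_sum_by_parts. do 2 f_equal. apply tri_ext. intros i j Hij Hj.
  rewrite Rabs_right; auto. pose proof (ordered_lt n X i j HX ltac:(lia)). lra.
Qed.

(** Normalized so that on ordered configurations it is [(m - 1) * FNm], and Euler's identity carries
    no constant. *)
Definition energy (n : nat) (m chi : R) (X : vec) : R :=
  gap_energy n m X - 2 * chi * tri_energy n m X.

Lemma pair_sum_energy n m X : ordered n X -> pair_sum (S n) m X = 2 * tri_energy n m X.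
Proof.
  intros HX. unfold pair_sum, tri_energy.
  rewrite (double_sum_sym (S n) (fun i j => Rpower (Rabs (X i - X j)) (1 - m)))
    by (intros i j; now rewrite (Rabs_minus_sym (X i))).
  f_equal. apply tri_ext. intros i j Hij Hj.
  pose proof (ordered_lt n X i j HX ltac:(lia)).
  rewrite Rabs_left by lra. f_equal. lra.
Qed.

Lemma near_sum_energy n m X : near_sum (S n) m X = gap_energy n m X.
Proof. unfold near_sum, gap_energy. now rewrite Nat.sub_succ, Nat.sub_0_r. Qed.

Lemma FNm_energy n m chi X : ordered n X ->
  FNm (S n) m chi X = / (m - 1) * energy n m chi X.
Proof.
  intros HX. unfold FNm, energy.
  rewrite pair_sum_energy, near_sum_energy by auto. unfold Rdiv. ring.
Qed.

Lemma flow_euler n m chi X : ordered n X ->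
  rsum (S n) (fun i => X i * flow_rhs (S n) m chi X i) = energy n m chi X.
Proof.
  intros HX. rewrite flow_sum_by_parts by auto. unfold energy, gap_energy, tri_energy.
  f_equal; [|f_equal].
  - apply rsum_ext; intros i Hi. symmetry. apply Rpower_pred.
    pose proof (HX i Hi). lra.
  - apply tri_ext; intros i j Hij Hj. symmetry. apply Rpower_pred.
    pose proof (ordered_lt n X i j HX ltac:(lia)). lra.
Qed.

(** Proved for every law [p] because the continued solution is built from the truncated flow and
    must stay centered. *)
Lemma flow_sum_zero p n chi X : rsum (S n) (flow_with p (S n) chi X) = 0.
Proof.
  rewrite (rsum_ext _ _ (fun i => 1 * flow_with p (S n) chi X i)) by (intros; ring).
  rewrite (flow_with_sum_by_parts p n chi X (fun _ => 1)).
  rewrite (rsum_ext n _ (fun _ => 0)) by (intros; ring).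
  rewrite (tri_ext (S n) _ (fun i j => 0 * 0)) by (intros; ring).
  rewrite tri_scal, rsum_const. ring.
Qed.

(** The curve is arbitrary: the formula is applied along solutions, along coordinate lines for
    [is_critical], and along a straight line through a minimizer. *)
Lemma energy_derive n m chi (U : R -> vec) v t :
  ordered n (U t) ->
  (forall i, (i < S n)%nat -> is_derive (fun s => U s i) t (v i)) ->
  is_derive (fun s => energy n m chi (U s)) t
    (- (m - 1) * rsum (S n) (fun i => v i * flow_rhs (S n) m chi (U t) i)).
Proof.
  intros HX HU.
  assert (Hd : forall i j, (i < j)%nat -> (j < S n)%nat ->
    is_derive (fun s => Rpower (U s j - U s i) (1 - m)) t
      ((1 - m) * (Rpower (U t j - U t i) (- m) * (v j - v i)))).
  { intros i j Hij Hj. pose proof (ordered_lt n (U t) i j HX ltac:(lia)).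
    replace ((1 - m) * (Rpower (U t j - U t i) (- m) * (v j - v i)))
      with (scal (v j - v i) ((1 - m) * Rpower (U t j - U t i) (1 - m - 1))).
    2:{ replace (1 - m - 1) with (- m) by ring. unfold scal; simpl; unfold mult; simpl. ring. }
    apply (is_derive_comp (fun y => Rpower y (1 - m)) (fun s => U s j - U s i)).
    - apply Rpower_derive. lra.
    - apply (is_derive_minus (K := R_AbsRing) (V := R_NormedModule)
        (fun s => U s j) (fun s => U s i)); apply HU; lia. }
  rewrite flow_sum_by_parts by auto.
  replace (- (m - 1) * _) with
    ((1 - m) * rsum n (fun k => Rpower (U t (k + 1)%nat - U t k) (- m) * (v (k + 1)%nat - v k))
     - 2 * chi * ((1 - m) * tri (S n) (fun i j => Rpower (U t j - U t i) (- m) * (v j - v i))))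
    by ring.
  rewrite <- rsum_scal, <- tri_scal.
  unfold energy, gap_energy, tri_energy.
  apply (is_derive_minus (K := R_AbsRing) (V := R_NormedModule)).
  - apply (rsum_derive n (fun k s => Rpower (U s (k + 1)%nat - U s k) (1 - m))).
    intros; apply Hd; lia.
  - apply is_derive_scal. unfold tri.
    apply (rsum_derive (S n) (fun j s => rsum j (fun i => Rpower (U s j - U s i) (1 - m)))).
    intros j Hj. apply (rsum_derive j (fun i s => Rpower (U s j - U s i) (1 - m))).
    intros; apply Hd; lia.
Qed.

Lemma ordered_locally n (U : R -> vec) t :
  (forall i, (i < S n)%nat -> continuous (fun s => U s i) t) ->
  ordered n (U t) -> locally t (fun s => ordered n (U s)).
Proof.
  intros Hc HX. induction n as [|n IH].
  - exists (mkposreal 1 Rlt_0_1). intros s _ i Hi. lia.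
  - assert (H1 : locally t (fun s => ordered n (U s))).
    { apply IH; [intros; apply Hc; lia|intros i Hi; apply HX; lia]. }
    assert (H2 : locally t (fun s => 0 < U s (n + 1)%nat - U s n)).
    { assert (Hd : continuous (fun s => U s (n + 1)%nat - U s n) t).
      { apply (continuous_minus (fun s => U s (n + 1)%nat) (fun s => U s n)); apply Hc; lia. }
      apply Hd. apply (open_gt 0). pose proof (HX n ltac:(lia)). lra. }
    generalize (filter_and _ _ H1 H2). apply filter_imp.
    intros s [Hi Hn] i Hlt. destruct (Nat.eq_dec i n) as [->|]; [lra|apply Hi; lia].
Qed.

Lemma rsum_indicator n f i : (i < n)%nat ->
  rsum n (fun k => (if Nat.eqb k i then 1 else 0) * f k) = f i.
Proof.
  induction n as [|n IH]; intros Hi; [lia|]. simpl.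
  destruct (Nat.eqb_spec n i) as [->|Hne].
  - rewrite (rsum_ext i _ (fun _ => 0)).
    + rewrite rsum_const. ring.
    + intros k Hk. destruct (Nat.eqb_spec k i); [lia|ring].
  - rewrite IH by lia. ring.
Qed.

Lemma critical_iff n m chi Y : 1 < m -> ordered n Y ->
  is_critical (S n) m chi Y <-> (forall i, (i < S n)%nat -> flow_rhs (S n) m chi Y i = 0).
Proof.
  intros Hm HY.
  assert (Hder : forall i, (i < S n)%nat ->
    is_derive (fun s => FNm (S n) m chi (fun k => if Nat.eqb k i then Y k + s else Y k)) 0
      (- flow_rhs (S n) m chi Y i)).
  { intros i Hi. set (U := fun (s : R) k => if Nat.eqb k i then Y k + s else Y k).
    assert (HU0 : U 0 = Y).
    { apply functional_extensionality; intros k. unfold U.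
      destruct (Nat.eqb k i); [ring|auto]. }
    assert (HU : forall k, (k < S n)%nat ->
      is_derive (fun s => U s k) 0 (if Nat.eqb k i then 1 else 0)).
    { intros k Hk. unfold U. destruct (Nat.eqb k i); auto_derive; auto. }
    apply is_derive_ext_loc with (fun s => / (m - 1) * energy n m chi (U s)).
    - assert (Hl : locally 0 (fun s => ordered n (U s))).
      { apply ordered_locally; [|now rewrite HU0].
        intros k Hk. apply (ex_derive_continuous (K := R_AbsRing) (V := R_NormedModule)).
        eexists; apply HU; auto. }
      revert Hl. apply filter_imp. intros s Hs. symmetry. apply (FNm_energy n m chi (U s) Hs).
    - replace (- flow_rhs (S n) m chi Y i) with (/ (m - 1) * (- (m - 1) *
        rsum (S n) (fun k => (if Nat.eqb k i then 1 else 0) * flow_rhs (S n) m chi (U 0) k))).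
      + apply is_derive_scal. apply energy_derive; auto. now rewrite HU0.
      + rewrite rsum_indicator, HU0 by auto. field. lra. }
  split; intros H i Hi.
  - pose proof (is_derive_unique _ _ _ (H i Hi)) as E1.
    pose proof (is_derive_unique _ _ _ (Hder i Hi)) as E2. rewrite E1 in E2. lra.
  - specialize (Hder i Hi). rewrite (H i Hi), Ropp_0 in Hder. exact Hder.
Qed.

Lemma is_derive_local_min f x l :
  is_derive f x l -> locally x (fun y => f x <= f y) -> l = 0.
Proof.
  intros Hd [d Hloc]. apply is_derive_Reals in Hd.
  destruct (Req_dec l 0) as [|Hl]; auto. exfalso.
  assert (Hp : 0 < Rabs l) by now apply Rabs_pos_lt.
  destruct (Hd (Rabs l) Hp) as [e He].
  set (k := Rmin d e / 2).
  assert (Hk : 0 < k /\ k < d /\ k < e).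
  { pose proof (Rmin_l d e). pose proof (Rmin_r d e).
    assert (0 < Rmin d e) by (apply Rmin_glb_lt; [apply (cond_pos d)|apply (cond_pos e)]).
    unfold k. lra. }
  set (h := if Rlt_dec 0 l then - k else k).
  assert (Hh : h <> 0 /\ Rabs h = k).
  { unfold h. destruct (Rlt_dec 0 l); split; try lra.
    - rewrite Rabs_Ropp. apply Rabs_right. lra.
    - apply Rabs_right. lra. }
  destruct Hh as [Hh0 Hh]. specialize (He h Hh0 ltac:(lra)).
  assert (Hf : f x <= f (x + h)).
  { apply Hloc. unfold ball; simpl; unfold AbsRing_ball, abs, minus, plus, opp; simpl.
    replace (x + h + - x) with h by ring. lra. }
  set (q := (f (x + h) - f x) / h) in *.
  assert (Hq : q * h = f (x + h) - f x) by (unfold q; field; auto).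
  clearbody q. apply Rabs_def2 in He. unfold h in Hq, Hf.
  destruct (Rlt_dec 0 l).
  - rewrite Rabs_right in He by lra. nra.
  - rewrite Rabs_left in He by lra. nra.
Qed.

(** Along the line through [Y] in the direction of its own flow, the energy has derivative
    [-(m - 1)] times the squared norm of that flow, and at a minimum this vanishes. *)
Lemma minimizer_critical n m chi Y : 1 < m -> ordered n Y -> energy n m chi Y = 0 ->
  (forall X, ordered n X -> 0 <= energy n m chi X) ->
  forall i, (i < S n)%nat -> flow_rhs (S n) m chi Y i = 0.
Proof.
  intros Hm HY H0 Hpos.
  set (v := flow_rhs (S n) m chi Y). set (U := fun (s : R) k => Y k + s * v k).
  assert (HU0 : U 0 = Y) by (apply functional_extensionality; intros k; unfold U; ring).
  assert (HU : forall k, (k < S n)%nat -> is_derive (fun s => U s k) 0 (v k)).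
  { intros k Hk. unfold U. auto_derive; auto. ring. }
  pose proof (energy_derive n m chi U v 0 ltac:(now rewrite HU0) HU) as Hd.
  apply is_derive_local_min in Hd.
  - rewrite HU0 in Hd. fold v in Hd.
    assert (Hs : rsum (S n) (fun i => v i * v i) = 0) by nra.
    intros i Hi. pose proof (rsum_term_le (S n) (fun i => v i * v i) i
      ltac:(intros; nra) Hi) as Hle. simpl in Hle, Hs. fold (v i). nra.
  - assert (Hl : locally 0 (fun s => ordered n (U s))).
    { apply ordered_locally; [|now rewrite HU0].
      intros k Hk. apply (ex_derive_continuous (K := R_AbsRing) (V := R_NormedModule)).
      eexists; apply HU; auto. }
    revert Hl. apply filter_imp. intros s Hs. rewrite HU0, H0. now apply Hpos.
Qed.

(** * Local existence for Lipschitz systems *)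

Lemma mvt_ball f df a b :
  (forall x, Rabs (x - a) <= Rabs (b - a) -> is_derive f x (df x)) ->
  exists c, Rabs (c - a) <= Rabs (b - a) /\ f b - f a = df c * (b - a).
Proof.
  intros H. destruct (Rle_dec a b) as [Hab|Hab].
  - destruct (mvt f df a b Hab) as [c [Hc E]].
    + intros x Hx. apply H. rewrite !Rabs_right by lra. lra.
    + exists c. split; auto. rewrite !Rabs_right by lra. lra.
  - destruct (mvt f df b a ltac:(lra)) as [c [Hc E]].
    + intros x Hx. apply H. rewrite (Rabs_left1 (x - a)), (Rabs_left1 (b - a)) by lra. lra.
    + exists c. split; [|lra]. rewrite (Rabs_left1 (c - a)), (Rabs_left1 (b - a)) by lra. lra.
Qed.

Lemma pow_half_small c : 0 < c -> forall b, 0 <= b -> exists k, b * (/ 2) ^ k < c.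
Proof.
  intros Hc b Hb. destruct (pow_lt_1_zero (/ 2) ltac:(rewrite Rabs_right; lra) (c / (b + 1))
    ltac:(apply Rdiv_lt_0_compat; lra)) as [k Hk].
  exists k. specialize (Hk k (le_n _)).
  assert (Hp : 0 < (/ 2) ^ k) by (apply pow_lt; lra).
  rewrite Rabs_right in Hk by lra.
  apply Rmult_lt_compat_r with (r := b + 1) in Hk; [|lra].
  replace (c / (b + 1) * (b + 1)) with c in Hk by (field; lra). nra.
Qed.

Lemma le_of_pow_half a b c : 0 <= c -> (forall k, a <= b + c * (/ 2) ^ k) -> a <= b.
Proof.
  intros Hc H. apply Rnot_lt_le. intros Hlt.
  destruct (pow_half_small (a - b) ltac:(lra) c Hc) as [k Hk]. specialize (H k). lra.
Qed.

(* [u k - 2 K 2^-k] is nondecreasing and bounded; its supremum is the limit. *)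
Lemma geometric_limit u K :
  (forall k, Rabs (u (S k) - u k) <= K * (/ 2) ^ k) ->
  exists l, forall k, Rabs (u k - l) <= 2 * K * (/ 2) ^ k.
Proof.
  intros H.
  assert (Hj : forall k j, u k - 2 * K * (/ 2) ^ k <= u (k + j)%nat - 2 * K * (/ 2) ^ (k + j) /\
     u (k + j)%nat + 2 * K * (/ 2) ^ (k + j) <= u k + 2 * K * (/ 2) ^ k).
  { intros k j. induction j as [|j IH]; [rewrite Nat.add_0_r; lra|].
    rewrite Nat.add_succ_r. pose proof (Rcomplements.Rabs_le_between (u (S (k + j)) - u (k + j)%nat)
      (K * (/ 2) ^ (k + j))) as [Hb _]. specialize (Hb (H (k + j)%nat)).
    change ((/ 2) ^ S (k + j)) with (/ 2 * (/ 2) ^ (k + j)). lra. }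
  assert (HK : 0 <= K).
  { specialize (H 0%nat). pose proof (Rabs_pos (u 1%nat - u 0%nat)). simpl in H. lra. }
  assert (Hp : forall k, 0 <= K * (/ 2) ^ k).
  { intros k. apply Rmult_le_pos; auto. apply pow_le. lra. }
  assert (Hub : forall k k', u k' - 2 * K * (/ 2) ^ k' <= u k + 2 * K * (/ 2) ^ k).
  { intros k k'. destruct (Nat.le_ge_cases k k') as [Hle|Hle].
    - replace k' with (k + (k' - k))%nat by lia. pose proof (Hj k (k' - k)%nat).
      pose proof (Hp (k + (k' - k))%nat). lra.
    - replace k with (k' + (k - k'))%nat by lia. pose proof (Hj k' (k - k')%nat).
      pose proof (Hp (k' + (k - k'))%nat). lra. }
  destruct (completeness (fun x => exists k, x = u k - 2 * K * (/ 2) ^ k)) as [l [Hl1 Hl2]].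
  - exists (u 0%nat + 2 * K * (/ 2) ^ 0). intros x [k ->]. apply Hub.
  - eexists. exists 0%nat. reflexivity.
  - exists l. intros k. apply Rabs_le.
    assert (u k - 2 * K * (/ 2) ^ k <= l) by (apply Hl1; eauto).
    assert (l <= u k + 2 * K * (/ 2) ^ k).
    { apply Hl2. intros x [k' ->]. apply Hub. }
    lra.
Qed.

Fixpoint picard_iterate (g : vec -> vec) (x0 : vec) (k : nat) (t : R) (i : nat) : R :=
  match k with
  | O => x0 i
  | S k => x0 i + RInt (fun s => g (picard_iterate g x0 k s) i) 0 t
  end.

Section Picard.

Variables (N : nat) (g : vec -> vec) (M L : R) (x0 : vec).
Hypothesis HM : 0 < M.
Hypothesis HL : 0 < L.
Hypothesis g_bounded : forall x i, (i < N)%nat -> Rabs (g x i) <= M.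
Hypothesis g_lipschitz : forall x y e,
  (forall j, (j < N)%nat -> Rabs (x j - y j) <= e) ->
  forall i, (i < N)%nat -> Rabs (g x i - g y i) <= L * e.

Lemma picard_continuous (U : R -> vec) i t : (i < N)%nat ->
  (forall j s t, (j < N)%nat -> Rabs (U s j - U t j) <= M * Rabs (s - t)) ->
  continuous (fun s => g (U s) i) t.
Proof.
  intros Hi HU. apply continuity_pt_filterlim. intros eps Heps.
  exists (eps / (L * M)). assert (0 < L * M) by nra.
  split; [apply Rdiv_lt_0_compat; lra|].
  intros s [_ Hs]. simpl in *. unfold Rdist in *.
  eapply Rle_lt_trans.
  - apply (g_lipschitz _ _ (M * Rabs (s - t))); auto.
  - apply Rmult_lt_compat_l with (r := L * M) in Hs; auto.
    replace (L * M * (eps / (L * M))) with eps in Hs by (field; lra). lra.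
Qed.

(** The Lipschitz bound on the iterate is a hypothesis because [picard_iterate_lipschitz] proves it
    by induction, using this derivative. *)
Lemma picard_iterate_derive k :
  (forall j s t, (j < N)%nat ->
     Rabs (picard_iterate g x0 k s j - picard_iterate g x0 k t j) <= M * Rabs (s - t)) ->
  forall i t, (i < N)%nat ->
    is_derive (fun s => picard_iterate g x0 (S k) s i) t (g (picard_iterate g x0 k t) i).
Proof.
  intros HU i t Hi. change (fun s => picard_iterate g x0 (S k) s i)
    with (fun s => x0 i + RInt (fun s => g (picard_iterate g x0 k s) i) 0 s).
  assert (H : is_derive (fun s => RInt (fun s => g (picard_iterate g x0 k s) i) 0 s) t
    (g (picard_iterate g x0 k t) i)).
  { apply (is_derive_RInt (V := R_NormedModule) (fun s => g (picard_iterate g x0 k s) i) _ 0 t).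
    - apply filter_forall. intros b. apply (RInt_correct (V := R_CompleteNormedModule)).
      apply (ex_RInt_continuous (V := R_CompleteNormedModule)).
      intros z _. now apply picard_continuous.
    - now apply picard_continuous. }
  apply is_derive_Reals in H. apply is_derive_Reals.
  rewrite <- (Rplus_0_l (g (picard_iterate g x0 k t) i)).
  apply (derivable_pt_lim_plus (fun _ => x0 i)); auto. apply derivable_pt_lim_const.
Qed.

Lemma picard_iterate_lipschitz k j s t : (j < N)%nat ->
  Rabs (picard_iterate g x0 k s j - picard_iterate g x0 k t j) <= M * Rabs (s - t).
Proof.
  revert j s t. induction k as [|k IH]; intros j s t Hj.
  - simpl. rewrite Rminus_diag, Rabs_R0. pose proof (Rabs_pos (s - t)). nra.
  - destruct (mvt_ball (fun s => picard_iterate g x0 (S k) s j)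
      (fun s => g (picard_iterate g x0 k s) j) t s) as [c [_ ->]].
    + intros x _. now apply picard_iterate_derive.
    + rewrite Rabs_mult. apply Rmult_le_compat_r; [apply Rabs_pos|auto].
Qed.

Lemma picard_iterate_0 k i : picard_iterate g x0 k 0 i = x0 i.
Proof.
  destruct k; simpl; auto. rewrite RInt_point. apply (plus_zero_r (G := R_AbelianMonoid)).
Qed.

(** Each iteration halves the difference: by the mean value theorem it is at most [L] times the
    previous difference times [h]. *)
Lemma picard_iterate_cauchy h k i t : L * h <= / 2 -> (i < N)%nat -> Rabs t <= h ->
  Rabs (picard_iterate g x0 (S k) t i - picard_iterate g x0 k t i) <= M * h * (/ 2) ^ k.
Proof.
  intros HLh. revert i t. induction k as [|k IH]; intros i t Hi Ht.
  - pose proof (picard_iterate_lipschitz 1 i t 0 Hi) as H.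
    rewrite picard_iterate_0, Rminus_0_r in H. simpl picard_iterate at 2.
    rewrite pow_O. nra.
  - pose proof (picard_iterate_lipschitz k) as Hk.
    pose proof (picard_iterate_lipschitz (S k)) as HSk.
    destruct (mvt_ball
      (fun s => picard_iterate g x0 (S (S k)) s i - picard_iterate g x0 (S k) s i)
      (fun s => g (picard_iterate g x0 (S k) s) i - g (picard_iterate g x0 k s) i) 0 t)
      as [c [Hc E]].
    + intros x _. apply (is_derive_minus (K := R_AbsRing) (V := R_NormedModule)
        (fun s => picard_iterate g x0 (S (S k)) s i) (fun s => picard_iterate g x0 (S k) s i));
        apply picard_iterate_derive; auto.
    + rewrite !Rminus_0_r in *. rewrite !picard_iterate_0, Rminus_diag, Rminus_0_r in E.
      rewrite E, Rabs_mult.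
      assert (H1 : Rabs (g (picard_iterate g x0 (S k) c) i - g (picard_iterate g x0 k c) i)
        <= L * (M * h * (/ 2) ^ k)).
      { apply g_lipschitz; auto. intros j Hj. apply IH; auto. lra. }
      assert (0 <= (/ 2) ^ k) by (apply pow_le; lra).
      pose proof (Rabs_pos t).
      assert (0 <= M * h * (/ 2) ^ k) by (repeat apply Rmult_le_pos; lra).
      eapply Rle_trans.
      { apply Rmult_le_compat; [apply Rabs_pos|apply Rabs_pos|apply H1|apply Ht]. }
      simpl pow. nra.
Qed.

(* The difference quotients of the iterates pass to the limit pointwise, with a
   quadratic error; no limit under the integral sign is needed. *)
Lemma picard : exists h (Y : R -> vec), 0 < h /\
  (forall i, (i < N)%nat -> Y 0 i = x0 i) /\
  (forall t i, Rabs t < h -> (i < N)%nat -> is_derive (fun s => Y s i) t (g (Y t) i)).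
Proof.
  set (h := / (2 * L)). assert (Hh : 0 < h) by (apply Rinv_0_lt_compat; lra).
  assert (HLh : L * h <= / 2) by (right; unfold h; field; lra).
  (* The restrictions on [t] and [i] are premises under the existential, so that a limit can be
     chosen for every [t] and [i]; outside them 0 is taken. *)
  assert (Hlim : forall t i, exists l, Rabs t <= h -> (i < N)%nat ->
    forall k, Rabs (picard_iterate g x0 k t i - l) <= 2 * (M * h) * (/ 2) ^ k).
  { intros t i. destruct (Rle_dec (Rabs t) h) as [Ht|]; [|exists 0; intros; lra].
    destruct (lt_dec i N) as [Hi|]; [|exists 0; intros; lia].
    destruct (geometric_limit (fun k => picard_iterate g x0 k t i) (M * h)) as [l Hl].
    - intros k. now apply picard_iterate_cauchy.
    - exists l. auto. }
  set (Y := fun t i => proj1_sig (constructive_indefinite_description _ (Hlim t i))).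
  assert (HY : forall t i, Rabs t <= h -> (i < N)%nat ->
    forall k, Rabs (picard_iterate g x0 k t i - Y t i) <= 2 * (M * h) * (/ 2) ^ k).
  { intros t i. unfold Y.
    destruct (constructive_indefinite_description _ (Hlim t i)) as [l Hl]. exact Hl. }
  exists h, Y. split; auto. split.
  { intros i Hi. assert (Rabs (x0 i - Y 0 i) <= 0).
    { apply le_of_pow_half with (2 * (M * h)); [nra|]. intros k.
      rewrite Rplus_0_l, <- (picard_iterate_0 k). apply HY; auto. rewrite Rabs_R0. lra. }
    pose proof (Rabs_pos (x0 i - Y 0 i)).
    assert (x0 i - Y 0 i = 0) by (apply Rabs_eq_0; lra). lra. }
  intros s i Hs Hi.
  (* The iterates are [M]-Lipschitz, so [g] along them varies by at most [L * M * |t - s|]: this is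
     the quadratic term. All other errors carry a factor [(/ 2) ^ k] and disappear. *)
  apply is_derive_of_quadratic with (L * M) (h - Rabs s); [lra|].
  intros t Ht.
  assert (Hball : forall c, Rabs (c - s) <= Rabs (t - s) -> Rabs c <= h).
  { intros c Hc. pose proof (Rabs_triang (c - s) s). replace (c - s + s) with c in H by ring. lra. }
  apply le_of_pow_half with (4 * (M * h) + Rabs (t - s) * L * (2 * (M * h))).
  { pose proof (Rabs_pos (t - s)). assert (0 <= M * h) by nra.
    apply Rplus_le_le_0_compat; [lra|]. repeat apply Rmult_le_pos; lra. }
  intros k. set (e := 2 * (M * h) * (/ 2) ^ k).
  destruct (mvt_ball (fun s => picard_iterate g x0 (S k) s i)
      (fun s => g (picard_iterate g x0 k s) i) s t) as [c [Hc E]].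
  { intros x _. apply picard_iterate_derive; auto. apply picard_iterate_lipschitz. }
  assert (H1 : Rabs (g (picard_iterate g x0 k c) i - g (Y s) i) <= L * (M * Rabs (t - s) + e)).
  { apply g_lipschitz; auto. intros j Hj.
    pose proof (picard_iterate_lipschitz k j c s Hj) as A1.
    pose proof (HY s j ltac:(lra) Hj k) as A2. fold e in A2.
    pose proof (Rabs_triang (picard_iterate g x0 k c j - picard_iterate g x0 k s j)
      (picard_iterate g x0 k s j - Y s j)) as A3.
    replace (picard_iterate g x0 k c j - picard_iterate g x0 k s j +
      (picard_iterate g x0 k s j - Y s j)) with (picard_iterate g x0 k c j - Y s j) in A3 by ring.
    pose proof (Rmult_le_compat_l M _ _ (Rlt_le _ _ HM) Hc). lra. }
  pose proof (HY t i (Hball t ltac:(lra)) Hi (S k)) as B1.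
  pose proof (HY s i ltac:(lra) Hi (S k)) as B2.
  assert (Hek : 2 * (M * h) * (/ 2) ^ S k = e / 2) by (unfold e; simpl; field).
  rewrite Hek in B1, B2.
  replace (Y t i - Y s i - (t - s) * g (Y s) i) with
    (- (picard_iterate g x0 (S k) t i - Y t i) + (picard_iterate g x0 (S k) s i - Y s i)
     + (t - s) * (g (picard_iterate g x0 k c) i - g (Y s) i)) by lra.
  eapply Rle_trans; [apply Rabs_triang|].
  eapply Rle_trans; [apply Rplus_le_compat_r, Rabs_triang|].
  rewrite Rabs_Ropp, Rabs_mult.
  pose proof (Rmult_le_compat_l _ _ _ (Rabs_pos (t - s)) H1) as H2.
  rewrite <- (pow2_abs (t - s)).
  replace ((4 * (M * h) + Rabs (t - s) * L * (2 * (M * h))) * (/ 2) ^ k)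
    with (2 * e + Rabs (t - s) * L * e) by (unfold e; ring).
  assert (0 <= e) by (repeat apply Rmult_le_pos; try apply pow_le; lra).
  nra.
Qed.

End Picard.

(** [f t + M * t] is nondecreasing and bounded, so its supremum plays the role of the limit at
    [b]. *)
Lemma lipschitz_left_limit f a b M :
  a < b -> (forall s t, a <= s < b -> a <= t < b -> Rabs (f s - f t) <= M * Rabs (s - t)) ->
  exists l, forall t, a <= t < b -> Rabs (f t - l) <= M * (b - t).
Proof.
  intros Hab H.
  assert (HM : 0 <= M).
  { pose proof (H a ((a + b) / 2) ltac:(lra) ltac:(lra)) as H1.
    pose proof (Rabs_pos (f a - f ((a + b) / 2))).
    assert (0 < Rabs (a - (a + b) / 2)) by (apply Rabs_pos_lt; lra). nra. }
  assert (Hub : forall s t, a <= s < b -> a <= t < b ->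
    f s + M * s <= f t + M * t + 2 * M * (b - t)).
  { intros s t Hs Ht. pose proof (H s t Hs Ht) as H1. apply Rabs_le_between in H1.
    destruct (Rle_dec s t); [rewrite Rabs_left1 in H1 by lra|rewrite Rabs_right in H1 by lra]; nra. }
  destruct (completeness (fun x => exists t, a <= t < b /\ x = f t + M * t)) as [S [HS1 HS2]].
  - exists (f a + M * a + 2 * M * (b - a)). intros x [t [Ht ->]]. apply Hub; lra.
  - exists (f a + M * a), a. split; [lra|auto].
  - exists (S - M * b). intros t Ht. apply Rabs_le.
    assert (f t + M * t <= S) by (apply HS1; eauto).
    assert (S <= f t + M * t + 2 * M * (b - t)).
    { apply HS2. intros x [s [Hs ->]]. now apply Hub. }
    lra.
Qed.

Lemma le_of_left_approx a b c t0 T :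
  t0 < T -> (forall t, t0 <= t < T -> a <= b + c * (T - t)) -> a <= b.
Proof.
  intros Ht H. apply Rnot_lt_le. intros Hlt.
  pose proof (Rabs_pos c) as Hc. pose proof (Rle_abs c).
  set (d := Rmin (T - t0) ((a - b) / (2 * (Rabs c + 1)))).
  assert (Hq : 0 < (a - b) / (2 * (Rabs c + 1))) by (apply Rdiv_lt_0_compat; lra).
  assert (Hd : 0 < d) by (apply Rmin_glb_lt; lra).
  assert (Hd1 : d <= T - t0) by apply Rmin_l.
  assert (Hd2 : d <= (a - b) / (2 * (Rabs c + 1))) by apply Rmin_r.
  specialize (H (T - d) ltac:(lra)). replace (T - (T - d)) with d in H by ring.
  apply Rmult_le_compat_r with (r := 2 * (Rabs c + 1)) in Hd2; [|lra].
  replace ((a - b) / (2 * (Rabs c + 1)) * (2 * (Rabs c + 1))) with (a - b) in Hd2 by (field; lra).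
  nra.
Qed.

(** * Continuation of solutions with separated particles *)

(** Frozen below distance [d], the interaction is bounded and Lipschitz on the whole line, as the
    Picard section demands; above [d] it is the true one. *)
Definition cut_power (m d : R) (x : R) : R := Rpower (Rmax d x) (- m).

Lemma cut_power_bounded m d x : 0 < m -> 0 < d -> Rabs (cut_power m d x) <= Rpower d (- m).
Proof.
  intros Hm Hd. unfold cut_power.
  rewrite Rabs_right by (left; apply Rpower_gt0).
  apply Rpower_decr; [lra|]. split; [auto|apply Rmax_l].
Qed.

Lemma Rmax_contract d x y : Rabs (Rmax d x - Rmax d y) <= Rabs (x - y).
Proof.
  unfold Rmax. destruct (Rle_dec d x), (Rle_dec d y); unfold Rabs;
    repeat destruct Rcase_abs; lra.
Qed.

Lemma cut_power_lipschitz m d x y : 0 < m -> 0 < d ->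
  Rabs (cut_power m d x - cut_power m d y) <= m * Rpower d (- m - 1) * Rabs (x - y).
Proof.
  intros Hm Hd.
  assert (Hle : forall u v, d <= u -> u <= v ->
    Rabs (Rpower v (- m) - Rpower u (- m)) <= m * Rpower d (- m - 1) * Rabs (v - u)).
  { intros u v Hu Huv.
    destruct (mvt (fun z => Rpower z (- m)) (fun z => - m * Rpower z (- m - 1)) u v Huv)
      as [c [Hc ->]].
    - intros z Hz. apply Rpower_derive. lra.
    - rewrite Rabs_mult. apply Rmult_le_compat_r; [apply Rabs_pos|].
      rewrite Rabs_mult, Rabs_Ropp, Rabs_right, Rabs_right by (try lra; left; apply Rpower_gt0).
      apply Rmult_le_compat_l; [lra|]. apply Rpower_decr; lra. }
  apply Rle_trans with (m * Rpower d (- m - 1) * Rabs (Rmax d x - Rmax d y)).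
  - unfold cut_power. pose proof (Rmax_l d x). pose proof (Rmax_l d y).
    destruct (Rle_dec (Rmax d x) (Rmax d y)).
    + rewrite Rabs_minus_sym, (Rabs_minus_sym (Rmax d x)). apply Hle; auto.
    + apply Hle; lra.
  - apply Rmult_le_compat_l; [|apply Rmax_contract].
    pose proof (Rpower_gt0 d (- m - 1)). nra.
Qed.

Lemma flow_with_bounded p N chi K x i : 0 <= chi -> 0 <= K ->
  (forall z, Rabs (p z) <= K) ->
  Rabs (flow_with p N chi x i) <= (2 + 2 * chi * INR N) * K.
Proof.
  intros Hchi HK Hp. unfold flow_with.
  assert (H1 : Rabs (if Nat.ltb (i + 1) N then - p (x (i + 1)%nat - x i) else 0) <= K).
  { destruct (Nat.ltb (i + 1) N); [rewrite Rabs_Ropp; auto|rewrite Rabs_R0; auto]. }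
  assert (H2 : Rabs (if Nat.ltb 0 i then p (x i - x (i - 1)%nat) else 0) <= K).
  { destruct (Nat.ltb 0 i); [auto|rewrite Rabs_R0; auto]. }
  set (S := rsum N _).
  assert (H3 : Rabs S <= INR N * K).
  { eapply Rle_trans; [apply rsum_Rabs|]. rewrite <- rsum_const. apply rsum_le.
    intros j _. destruct (Nat.eqb j i); [rewrite Rabs_R0; auto|].
    unfold sgn_nat. rewrite Rabs_mult.
    destruct (Nat.ltb i j); [rewrite Rabs_R1, Rmult_1_l; auto|].
    destruct (Nat.ltb j i).
    - rewrite (Rabs_left (-1)) by lra. replace (- -1) with 1 by lra. rewrite Rmult_1_l; auto.
    - rewrite Rabs_R0. lra. }
  eapply Rle_trans; [apply Rabs_triang|].
  pose proof (Rabs_triang (if Nat.ltb (i + 1) N then - p (x (i + 1)%nat - x i) else 0)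
    (if Nat.ltb 0 i then p (x i - x (i - 1)%nat) else 0)).
  rewrite Rabs_mult, (Rabs_right (2 * chi)) by lra.
  pose proof (Rmult_le_compat_l (2 * chi) _ _ ltac:(lra) H3). lra.
Qed.

Lemma flow_with_lipschitz p N chi K x y e : 0 <= chi -> 0 <= K ->
  (forall u v, Rabs (p u - p v) <= K * Rabs (u - v)) ->
  (forall j, (j < N)%nat -> Rabs (x j - y j) <= e) ->
  forall i, (i < N)%nat ->
    Rabs (flow_with p N chi x i - flow_with p N chi y i)
      <= (2 + 2 * chi * INR N) * (2 * K) * e.
Proof.
  intros Hchi HK Hp He i Hi.
  assert (He0 : 0 <= e) by (pose proof (He i Hi); pose proof (Rabs_pos (x i - y i)); lra).
  assert (HKe : 0 <= 2 * K * e) by (repeat apply Rmult_le_pos; lra).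
  assert (Hd : forall a b, (a < N)%nat -> (b < N)%nat ->
    Rabs ((x a - x b) - (y a - y b)) <= 2 * e).
  { intros a b Ha Hb. pose proof (He a Ha) as Ea. pose proof (He b Hb) as Eb.
    apply Rabs_le_between in Ea. apply Rabs_le_between in Eb. apply Rabs_le. lra. }
  assert (Hpd : forall a b, (a < N)%nat -> (b < N)%nat ->
    Rabs (p (x a - x b) - p (y a - y b)) <= 2 * K * e).
  { intros a b Ha Hb. eapply Rle_trans; [apply Hp|].
    pose proof (Rmult_le_compat_l K _ _ HK (Hd a b Ha Hb)). lra. }
  unfold flow_with.
  set (a1 := if Nat.ltb (i + 1) N then - p (x (i + 1)%nat - x i) else 0).
  set (b1 := if Nat.ltb (i + 1) N then - p (y (i + 1)%nat - y i) else 0).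
  set (a2 := if Nat.ltb 0 i then p (x i - x (i - 1)%nat) else 0).
  set (b2 := if Nat.ltb 0 i then p (y i - y (i - 1)%nat) else 0).
  assert (H1 : Rabs (a1 - b1) <= 2 * K * e).
  { unfold a1, b1. destruct (Nat.ltb_spec (i + 1) N).
    - rewrite Rabs_minus_sym.
      replace (- p (y (i + 1)%nat - y i) - - p (x (i + 1)%nat - x i)) with
        (p (x (i + 1)%nat - x i) - p (y (i + 1)%nat - y i)) by ring. auto.
    - rewrite Rminus_diag, Rabs_R0. auto. }
  assert (H2 : Rabs (a2 - b2) <= 2 * K * e).
  { unfold a2, b2. destruct (Nat.ltb_spec 0 i).
    - apply Hpd; lia.
    - rewrite Rminus_diag, Rabs_R0. auto. }
  set (S := rsum N _). set (S' := rsum N _).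
  assert (H3 : Rabs (S - S') <= INR N * (2 * K * e)).
  { unfold S, S'. rewrite <- rsum_minus.
    eapply Rle_trans; [apply rsum_Rabs|]. rewrite <- rsum_const. apply rsum_le.
    intros j Hj. destruct (Nat.eqb j i); [rewrite Rminus_diag, Rabs_R0; auto|].
    rewrite <- Rmult_minus_distr_l, Rabs_mult.
    assert (Hq : Rabs (p (Rabs (x j - x i)) - p (Rabs (y j - y i))) <= 2 * K * e).
    { eapply Rle_trans; [apply Hp|].
      pose proof (Rabs_triang_inv2 (x j - x i) (y j - y i)) as Ht.
      pose proof (Hd j i Hj Hi).
      pose proof (Rmult_le_compat_l K _ _ HK (Rle_trans _ _ _ Ht H)). lra. }
    unfold sgn_nat. destruct (Nat.ltb i j); [rewrite Rabs_R1, Rmult_1_l; auto|].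
    destruct (Nat.ltb j i).
    - rewrite (Rabs_left (-1)) by lra. replace (- -1) with 1 by lra. rewrite Rmult_1_l; auto.
    - rewrite Rabs_R0. lra. }
  replace (a1 + a2 + 2 * chi * S - (b1 + b2 + 2 * chi * S')) with
    ((a1 - b1) + (a2 - b2) + 2 * chi * (S - S')) by ring.
  eapply Rle_trans; [apply Rabs_triang|].
  pose proof (Rabs_triang (a1 - b1) (a2 - b2)).
  rewrite Rabs_mult, (Rabs_right (2 * chi)) by lra.
  pose proof (Rmult_le_compat_l (2 * chi) _ _ ltac:(lra) H3). lra.
Qed.

Definition separated (n : nat) (d : R) (X : vec) : Prop :=
  forall i : nat, (i < n)%nat -> d <= X (i + 1)%nat - X i.

Lemma separated_ordered n d X : 0 < d -> separated n d X -> ordered n X.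
Proof. intros Hd H i Hi. pose proof (H i Hi). lra. Qed.

Lemma separated_flow n m chi d X i : 0 < d -> separated n d X -> (i < S n)%nat ->
  flow_rhs (S n) m chi X i = flow_with (cut_power m d) (S n) chi X i.
Proof.
  intros Hd H Hi. pose proof (separated_ordered n d X Hd H) as HX.
  assert (Hab : forall a b, (a < b <= n)%nat -> d <= X b - X a).
  { intros a b Hab. pose proof (H a ltac:(lia)).
    pose proof (ordered_le n X (a + 1) b HX ltac:(lia)). lra. }
  unfold flow_rhs, flow_with, cut_power. f_equal; [f_equal|f_equal].
  - destruct (Nat.ltb_spec (i + 1) (S n)); auto.
    rewrite Rmax_right; auto. apply Hab. lia.
  - destruct (Nat.ltb_spec 0 i); auto.
    rewrite Rmax_right; auto. apply Hab. lia.
  - apply rsum_ext. intros j Hj. destruct (Nat.eqb_spec j i); auto.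
    rewrite Rmax_right; auto.
    destruct (Nat.lt_ge_cases i j).
    + pose proof (Hab i j ltac:(lia)). rewrite Rabs_right; lra.
    + pose proof (Hab j i ltac:(lia)). rewrite Rabs_left1; lra.
Qed.

(** Bounded velocities give a limit configuration at [T], still with gaps at least [d], from which a
    Picard solution is started and glued on. The delicate point is the two-sided derivative at
    [T]. *)
Lemma extend_solution n m chi X0 T X t0 d :
  0 < m -> 0 <= chi -> is_solution (S n) m chi X0 (Finite T) X ->
  0 < t0 < T -> 0 < d -> (forall t, t0 <= t < T -> separated n d (X t)) ->
  exists (T' : Rbar) (X' : R -> vec), Rbar_lt T T' /\ is_solution (S n) m chi X0 T' X' /\
    (forall t i, 0 <= t -> Rbar_lt t T -> (i < S n)%nat -> X' t i = X t i).
Proof.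
  intros Hm Hchi [HT0 [HX0 [HRN [Hlim Hder]]]] Ht0 Hd Hsep.
  (* Cutting at [d / 2] rather than [d] leaves room for the new piece to shrink the gaps for a
     while. *)
  set (p := cut_power m (d / 2)). set (g := flow_with p (S n) chi).
  assert (Hg : forall x i, separated n (d / 2) x -> (i < S n)%nat ->
    flow_rhs (S n) m chi x i = g x i) by (intros; apply separated_flow; auto; lra).
  set (K := Rpower (d / 2) (- m)). set (K' := m * Rpower (d / 2) (- m - 1)).
  assert (HK : 0 < K) by apply Rpower_gt0.
  assert (HK' : 0 < K') by (apply Rmult_lt_0_compat; [lra|apply Rpower_gt0]).
  pose proof (pos_INR (S n)) as HN.
  assert (Hc : 0 < 2 + 2 * chi * INR (S n)).
  { assert (0 <= chi * INR (S n)) by (apply Rmult_le_pos; lra). lra. }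
  set (M := (2 + 2 * chi * INR (S n)) * K). set (L := (2 + 2 * chi * INR (S n)) * (2 * K')).
  assert (HM : 0 < M) by (apply Rmult_lt_0_compat; lra).
  assert (HL : 0 < L) by (apply Rmult_lt_0_compat; lra).
  assert (gb : forall x i, (i < S n)%nat -> Rabs (g x i) <= M).
  { intros. apply flow_with_bounded; auto; [lra|]. intros; apply cut_power_bounded; lra. }
  assert (gl : forall x y e, (forall j, (j < S n)%nat -> Rabs (x j - y j) <= e) ->
    forall i, (i < S n)%nat -> Rabs (g x i - g y i) <= L * e).
  { intros. apply flow_with_lipschitz; auto; [lra|]. intros; apply cut_power_lipschitz; lra. }
  assert (HdX : forall t i, t0 <= t < T -> (i < S n)%nat ->
    is_derive (fun s => X s i) t (g (X t) i)).
  { intros t i Ht Hi. rewrite <- Hg; auto.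
    - apply Hder; auto; simpl; lra.
    - intros k Hk. pose proof (Hsep t Ht k Hk). lra. }
  assert (HXmvt : forall i s t, (i < S n)%nat -> t0 <= s < T -> t0 <= t < T -> s <= t ->
    exists c, s <= c <= t /\ X t i - X s i = g (X c) i * (t - s)).
  { intros i s t Hi Hs Ht Hst. apply (mvt (fun s => X s i) (fun s => g (X s) i)); auto.
    intros x Hx. apply HdX; auto. lra. }
  assert (HXl : forall i s t, (i < S n)%nat -> t0 <= s < T -> t0 <= t < T ->
    Rabs (X s i - X t i) <= M * Rabs (s - t)).
  { intros i s t Hi Hs Ht. destruct (Rle_dec s t).
    - destruct (HXmvt i s t Hi Hs Ht ltac:(lra)) as [c [_ E]].
      rewrite Rabs_minus_sym, E, Rabs_mult, (Rabs_minus_sym s).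
      apply Rmult_le_compat_r; [apply Rabs_pos|auto].
    - destruct (HXmvt i t s Hi Ht Hs ltac:(lra)) as [c [_ E]].
      rewrite E, Rabs_mult. apply Rmult_le_compat_r; [apply Rabs_pos|auto]. }
  assert (Hex : forall i, exists l, (i < S n)%nat -> forall t, t0 <= t < T ->
    Rabs (X t i - l) <= M * (T - t)).
  { intros i. destruct (lt_dec i (S n)) as [Hi|]; [|exists 0; intros; lia].
    destruct (lipschitz_left_limit (fun t => X t i) t0 T M ltac:(lra)) as [l Hl]; [auto|].
    exists l. auto. }
  apply functional_choice in Hex. destruct Hex as [l Hl].
  assert (Hlsep : separated n d l).
  { intros i Hi. apply (le_of_left_approx _ _ (2 * M) t0 T); [lra|]. intros t Ht.
    pose proof (Hsep t Ht i Hi). pose proof (Hl i ltac:(lia) t Ht) as A1.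
    pose proof (Hl (i + 1)%nat ltac:(lia) t Ht) as A2.
    apply Rabs_le_between in A1. apply Rabs_le_between in A2. lra. }
  assert (Hlsum : rsum (S n) l = 0).
  { assert (Hs : Rabs (rsum (S n) l) <= 0).
    { apply (le_of_left_approx _ _ (INR (S n) * M) t0 T); [lra|]. intros t Ht.
      destruct (HRN t ltac:(lra) ltac:(simpl; lra)) as [_ Hz].
      replace (rsum (S n) l) with (- (rsum (S n) (X t) - rsum (S n) l)) by lra.
      rewrite <- rsum_minus, Rabs_Ropp. eapply Rle_trans; [apply rsum_Rabs|].
      rewrite Rplus_0_l, Rmult_assoc, <- rsum_const. apply rsum_le. intros i Hi. auto. }
    pose proof (Rabs_pos (rsum (S n) l)). apply Rabs_eq_0. lra. }
  destruct (picard (S n) g M L l HM HL gb gl) as [h [Z [Hh [HZ0 HZ]]]].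
  assert (HZmvt : forall i s, (i < S n)%nat -> Rabs s < h ->
    exists c, Rabs c <= Rabs s /\ Z s i - l i = g (Z c) i * s).
  { intros i s Hi Hs. destruct (mvt_ball (fun s => Z s i) (fun s => g (Z s) i) 0 s) as [c [Hcc E]].
    - intros x Hx. rewrite !Rminus_0_r in Hx. apply HZ; auto. lra.
    - rewrite !Rminus_0_r in *. rewrite HZ0 in E by auto. eauto. }
  assert (HZl : forall i s, (i < S n)%nat -> Rabs s < h -> Rabs (Z s i - l i) <= M * Rabs s).
  { intros i s Hi Hs. destruct (HZmvt i s Hi Hs) as [c [_ ->]].
    rewrite Rabs_mult. apply Rmult_le_compat_r; [apply Rabs_pos|auto]. }
  (* In this time each particle moves by at most [d / 4], so no gap loses more than [d / 2]. *)
  set (h1 := Rmin h (d / (4 * M))).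
  assert (Hh1 : 0 < h1) by (apply Rmin_glb_lt; auto; apply Rdiv_lt_0_compat; lra).
  assert (Hh1h : h1 <= h) by apply Rmin_l.
  assert (Hh1d : M * h1 <= d / 4).
  { assert (h1 <= d / (4 * M)) by apply Rmin_r.
    apply (Rmult_le_compat_l M) in H; [|lra].
    replace (M * (d / (4 * M))) with (d / 4) in H by (field; lra). lra. }
  assert (HZsep : forall s, Rabs s < h1 -> separated n (d / 2) (Z s)).
  { intros s Hs i Hi. pose proof (Hlsep i Hi).
    pose proof (HZl i s ltac:(lia) ltac:(lra)) as A1.
    pose proof (HZl (i + 1)%nat s ltac:(lia) ltac:(lra)) as A2.
    apply Rabs_le_between in A1. apply Rabs_le_between in A2.
    pose proof (Rmult_le_compat_l M _ _ (Rlt_le _ _ HM) (Rlt_le _ _ Hs)). lra. }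
  assert (HZsum : forall s, Rabs s < h1 -> rsum (S n) (Z s) = 0).
  { intros s Hs.
    destruct (mvt_ball (fun s => rsum (S n) (fun i => Z s i)) (fun s => rsum (S n) (g (Z s))) 0 s)
      as [c [_ E]].
    - intros x Hx. rewrite !Rminus_0_r in Hx.
      apply (rsum_derive (S n) (fun i s => Z s i)). intros i Hi. apply HZ; auto. lra.
    - unfold g in E. rewrite flow_sum_zero in E.
      rewrite (rsum_ext _ (fun i => Z 0 i) l) in E by auto. rewrite Hlsum in E.
      change (rsum (S n) (fun i => Z s i)) with (rsum (S n) (Z s)) in E. lra. }
  (* At [T] itself the new piece is used: the value of [X] there is unconstrained. *)
  set (Y := fun t i => if Rlt_dec t T then X t i else Z (t - T) i).
  assert (HYX : forall t, t < T -> Y t = X t).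
  { intros t Ht. unfold Y. apply functional_extensionality; intros i.
    destruct (Rlt_dec t T); [auto|lra]. }
  assert (HYZ : forall t, T <= t -> Y t = Z (t - T)).
  { intros t Ht. unfold Y. apply functional_extensionality; intros i.
    destruct (Rlt_dec t T); [lra|auto]. }
  exists (Finite (T + h1)), Y. split; [simpl; lra|]. split.
  2:{ intros t i _ Ht _. simpl in Ht. now rewrite HYX. }
  simpl in HT0. assert (HY0 : Y 0 = X 0) by (apply HYX; lra).
  split; [simpl; lra|]. split; [intros i Hi; rewrite HY0; auto|]. split; [|split].
  - intros t Ht Htl. simpl in Htl. destruct (Rlt_dec t T) as [H|H].
    + rewrite HYX by auto. apply HRN; auto.
    + rewrite HYZ by lra. assert (Rabs (t - T) < h1) by (rewrite Rabs_right; lra). split.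
      * intros i Hi. apply (separated_ordered n (d / 2)); auto; [lra|lia].
      * auto.
  - intros i Hi. rewrite HY0. apply (filterlim_ext_loc (fun s => X s i)); auto.
    exists (mkposreal T HT0). intros s Hs _. rewrite HYX; auto.
    unfold ball in Hs; simpl in Hs; unfold AbsRing_ball, abs, minus, plus, opp in Hs; simpl in Hs.
    apply Rabs_def2 in Hs. lra.
  - intros t i Ht Htl Hi. simpl in Htl.
    destruct (Rtotal_order t T) as [H|[H|H]].
    + rewrite HYX by auto. apply is_derive_ext_loc with (fun s => X s i).
      * assert (Hp : 0 < T - t) by lra. exists (mkposreal _ Hp). intros s Hs.
        unfold ball in Hs; simpl in Hs; unfold AbsRing_ball, abs, minus, plus, opp in Hs;
          simpl in Hs. apply Rabs_def2 in Hs. rewrite HYX; auto. lra.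
      * apply Hder; auto.
    + subst t. rewrite HYZ, Rminus_diag by lra. rewrite Hg; auto.
      2:{ apply HZsep. rewrite Rabs_R0. auto. }
      assert (HYT : Y T i = l i) by (rewrite HYZ, Rminus_diag by lra; auto).
      assert (Hgl : g (Z 0) i = g l i).
      { assert (Hz : Rabs (g (Z 0) i - g l i) <= L * 0).
        { apply gl; auto. intros j Hj. rewrite HZ0 by auto. rewrite Rminus_diag, Rabs_R0. lra. }
        pose proof (Rabs_pos (g (Z 0) i - g l i)).
        assert (g (Z 0) i - g l i = 0) by (apply Rabs_eq_0; lra). lra. }
      rewrite Hgl.
      apply is_derive_of_quadratic with (L * M) (Rmin (T - t0) h).
      { apply Rmin_glb_lt; lra. }
      intros t Htt. rewrite HYT. pose proof (Rmin_l (T - t0) h). pose proof (Rmin_r (T - t0) h).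
      destruct (Rlt_dec t T) as [HtT|HtT].
      * rewrite HYX by auto. rewrite Rabs_left in Htt by lra.
        (* [X] is controlled only before [T], so the increment from [t] to [T] is compared with the
           one from [t] to [s], and [s] tends to [T]. *)
        apply (le_of_left_approx _ _ (2 * M) t T); [lra|]. intros s Hs.
        destruct (HXmvt i t s Hi ltac:(lra) ltac:(lra) ltac:(lra)) as [c [Hcc E]].
        assert (A1 : Rabs (g (X c) i - g l i) <= L * (M * (T - c))).
        { apply gl; auto. intros j Hj. apply Hl; auto. lra. }
        assert (A2 : Rabs (g (X c) i - g l i) * (s - t) <= L * M * (t - T) ^ 2).
        { assert (L * (M * (T - c)) <= L * (M * (T - t))) by (apply Rmult_le_compat_l; nra).
          apply Rle_trans with (L * (M * (T - t)) * (T - t)); [|right; ring].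
          apply Rmult_le_compat; try lra. apply Rabs_pos. }
        pose proof (Hl i Hi s ltac:(lra)) as A3.
        assert (A4 : Rabs ((s - T) * g l i) <= M * (T - s)).
        { rewrite Rabs_mult, (Rabs_left (s - T)) by lra.
          pose proof (gb l i Hi). nra. }
        replace (X t i - l i - (t - T) * g l i) with
          (- ((g (X c) i - g l i) * (s - t)) + (X s i - l i) + - ((s - T) * g l i)) by lra.
        eapply Rle_trans; [apply Rabs_triang|].
        eapply Rle_trans; [apply Rplus_le_compat_r, Rabs_triang|].
        rewrite !Rabs_Ropp, Rabs_mult, (Rabs_right (s - t)) by lra. lra.
      * rewrite HYZ by lra. assert (Hth : Rabs (t - T) < h) by lra.
        destruct (HZmvt i (t - T) Hi Hth) as [c [Hcc E]]. rewrite E.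
        replace (g (Z c) i * (t - T) - (t - T) * g l i) with
          ((g (Z c) i - g l i) * (t - T)) by ring.
        rewrite Rabs_mult.
        assert (A1 : Rabs (g (Z c) i - g l i) <= L * (M * Rabs c)).
        { apply gl; auto. intros j Hj. apply HZl; auto. lra. }
        rewrite <- (pow2_abs (t - T)).
        assert (A2 : L * (M * Rabs c) <= L * (M * Rabs (t - T))).
        { do 2 (apply Rmult_le_compat_l; [lra|]). auto. }
        pose proof (Rmult_le_compat_r _ _ _ (Rabs_pos (t - T)) (Rle_trans _ _ _ A1 A2)). nra.
    + rewrite HYZ by lra. assert (Hth : Rabs (t - T) < h1) by (rewrite Rabs_right; lra).
      rewrite Hg; auto.
      apply is_derive_ext_loc with (fun s => Z (s - T) i).
      * assert (Hp : 0 < t - T) by lra. exists (mkposreal _ Hp). intros s Hs.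
        unfold ball in Hs; simpl in Hs; unfold AbsRing_ball, abs, minus, plus, opp in Hs;
          simpl in Hs. apply Rabs_def2 in Hs. rewrite HYZ; auto. lra.
      * replace (g (Z (t - T)) i) with (scal 1 (g (Z (t - T)) i)).
        2:{ unfold scal; simpl; unfold mult; simpl. ring. }
        apply (is_derive_comp (fun s => Z s i) (fun s => s - T)).
        -- apply HZ; auto. lra.
        -- auto_derive; auto.
Qed.

(** * Rigidity of critical configurations *)

Section Jensen.

Variables (n : nat) (m chi : R) (Y Z : vec) (L : R).
Hypothesis Hm : 1 < m.
Hypothesis Hchi : 0 < chi.
Hypothesis HY : ordered n Y.
Hypothesis HZ : ordered n Z.
Hypothesis HL : forall k, (k < n)%nat -> Z (k + 1)%nat - Z k <= L * (Y (k + 1)%nat - Y k).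

Let y (k : nat) : R := Y (k + 1)%nat - Y k.
Let ratio (k : nat) : R := (Z (k + 1)%nat - Z k) / y k.
Let kappa : R := m * (m - 1) / 2 * Rpower L (- m - 1).

(** [lam] is the mean of the ratios with weights [y / E]. In the tangent inequality at [lam] the
    linear terms thus cancel, and the quadratic ones add up to a weighted variance. *)
Lemma jensen_pair i l : (0 < l)%nat -> (i + l <= n)%nat ->
  let E := Y (i + l)%nat - Y i in
  let lam := (Z (i + l)%nat - Z i) / E in
  Rpower (Z (i + l)%nat - Z i) (1 - m)
    + Rpower E (- m) * (kappa * rsum l (fun k => y (i + k) * (ratio (i + k) - lam) ^ 2))
  <= Rpower E (- m) * rsum l (fun k => y (i + k) * Rpower (ratio (i + k)) (1 - m)).
Proof.
  intros Hl Hil E lam.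
  assert (HE : 0 < E).
  { unfold E. pose proof (ordered_lt n Y i (i + l) HY ltac:(lia)). lra. }
  assert (HD : 0 < Z (i + l)%nat - Z i).
  { pose proof (ordered_lt n Z i (i + l) HZ ltac:(lia)). lra. }
  assert (Hlam : 0 < lam) by now apply Rdiv_lt_0_compat.
  assert (Hy : forall k, (k < n)%nat -> 0 < y k).
  { intros k Hk. unfold y. pose proof (HY k Hk). lra. }
  assert (Hr : forall k, (k < n)%nat -> 0 < ratio k <= L).
  { intros k Hk. specialize (Hy k Hk). pose proof (HZ k Hk). pose proof (HL k Hk) as Hk'.
    unfold ratio. split; [apply Rdiv_lt_0_compat; lra|].
    apply Rmult_le_reg_r with (y k); auto. unfold Rdiv.
    rewrite Rmult_assoc, Rinv_l by lra. unfold y. lra. }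
  assert (SE : rsum l (fun k => y (i + k)%nat) = E) by apply (rsum_telescope l Y i).
  assert (SZ : rsum l (fun k => y (i + k)%nat * ratio (i + k)%nat) = lam * E).
  { replace (lam * E) with (Z (i + l)%nat - Z i) by (unfold lam; field; lra).
    rewrite <- (rsum_telescope l Z i). apply rsum_ext. intros k Hk.
    specialize (Hy (i + k)%nat ltac:(lia)). unfold ratio. field. lra. }
  assert (HlamL : lam <= L).
  { apply Rmult_le_reg_r with E; auto. rewrite <- SZ, <- SE, <- rsum_scal.
    apply rsum_le. intros k Hk. specialize (Hy (i + k)%nat ltac:(lia)).
    specialize (Hr (i + k)%nat ltac:(lia)). nra. }
  set (S := rsum l (fun k => y (i + k)%nat * (ratio (i + k)%nat - lam) ^ 2)).
  assert (HS : E * Rpower lam (1 - m) + kappa * S <=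
    rsum l (fun k => y (i + k)%nat * Rpower (ratio (i + k)%nat) (1 - m))).
  { replace (E * Rpower lam (1 - m) + kappa * S) with
      (rsum l (fun k => Rpower lam (1 - m) * y (i + k)%nat
        - (m - 1) * Rpower lam (- m) * (y (i + k)%nat * ratio (i + k)%nat - lam * y (i + k)%nat)
        + kappa * (y (i + k)%nat * (ratio (i + k)%nat - lam) ^ 2))).
    - apply rsum_le. intros k Hk. specialize (Hy (i + k)%nat ltac:(lia)).
      pose proof (Rpower_tangent m L lam (ratio (i + k)%nat) Hm (conj Hlam HlamL)
        (Hr (i + k)%nat ltac:(lia))) as Ht. fold kappa in Ht.
      apply (Rmult_le_compat_l (y (i + k)%nat)) in Ht; [|lra].
      eapply Rle_trans; [|apply Ht]. right. ring.
    - rewrite rsum_plus, rsum_minus, !rsum_scal, rsum_minus, rsum_scal, SE, SZ.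
      fold S. ring. }
  apply (Rmult_le_compat_l (Rpower E (- m))) in HS; [|left; apply Rpower_gt0].
  eapply Rle_trans; [|apply HS]. right.
  rewrite Rmult_plus_distr_l. f_equal.
  (* [E ^ (- m) * E * lam ^ (1 - m) = (E * lam) ^ (1 - m)], and [E * lam] is the distance of the
     pair in [Z]. *)
  rewrite <- Rmult_assoc, <- Rpower_pred, Rpower_mult_distr by auto.
  f_equal. unfold lam. field. lra.
Qed.

(* Criticality of [Y], tested against the displacement with increments
   [y k * ratio k ^ (1 - m)], turns the gap energy of [Z] into a sum over pairs, which
   Jensen's inequality compares with the pair energy of [Z]. *)
Lemma energy_defect : (0 < n)%nat ->
  (forall i, (i < S n)%nat -> flow_rhs (S n) m chi Y i = 0) ->
  2 * chi * (Rpower (Y n - Y 0%nat) (- m) * (kappa *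
    rsum n (fun k => y k * (ratio k - (Z n - Z 0%nat) / (Y n - Y 0%nat)) ^ 2)))
  <= energy n m chi Z.
Proof.
  intros Hn Hcrit.
  (* The increment [y k * ratio k ^ (1 - m)] is chosen so that, multiplied by [y k ^ (- m)], it
     gives [(y k * ratio k) ^ (1 - m)], the gap term of [Z]. *)
  set (v := fun j => rsum j (fun k => y k * Rpower (ratio k) (1 - m))).
  assert (Hk0 : 0 <= kappa).
  { unfold kappa. pose proof (Rpower_gt0 L (- m - 1)). apply Rmult_le_pos; [|lra]. nra. }
  assert (Hy : forall k, (k < n)%nat -> 0 < y k).
  { intros k Hk. unfold y. pose proof (HY k Hk). lra. }
  assert (HG : gap_energy n m Z =
    2 * chi * tri (S n) (fun i j => Rpower (Y j - Y i) (- m) * (v j - v i))).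
  { pose proof (flow_sum_by_parts n m chi Y v HY) as Hs.
    rewrite (rsum_ext (S n) _ (fun _ => 0)) in Hs by (intros i Hi; rewrite Hcrit by auto; ring).
    rewrite rsum_const, Rmult_0_r in Hs.
    rewrite (rsum_ext n _ (fun k => Rpower (Z (k + 1)%nat - Z k) (1 - m))) in Hs.
    { unfold gap_energy. lra. }
    intros k Hk. specialize (Hy k Hk). pose proof (HZ k Hk).
    fold (y k). unfold v. rewrite Nat.add_1_r. simpl rsum.
    replace (rsum k (fun k => y k * Rpower (ratio k) (1 - m)) + y k * Rpower (ratio k) (1 - m)
      - rsum k (fun k => y k * Rpower (ratio k) (1 - m))) with
      (y k * Rpower (ratio k) (1 - m)) by ring.
    rewrite <- Rmult_assoc, <- Rpower_pred by auto.
    assert (0 < ratio k) by (apply Rdiv_lt_0_compat; lra).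
    rewrite Rpower_mult_distr by auto. f_equal.
    unfold ratio. rewrite Nat.add_1_r. field. lra. }
  unfold energy. rewrite HG. unfold tri_energy.
  rewrite <- Rmult_minus_distr_l, <- tri_minus.
  apply Rmult_le_compat_l; [lra|].
  assert (Hdef : forall i j, (i < j)%nat -> (j < S n)%nat ->
    Rpower (Y j - Y i) (- m) * (kappa *
      rsum (j - i) (fun k => y (i + k)%nat *
        (ratio (i + k)%nat - (Z j - Z i) / (Y j - Y i)) ^ 2))
    <= Rpower (Y j - Y i) (- m) * (v j - v i) - Rpower (Z j - Z i) (1 - m)).
  { intros i j Hij Hj. pose proof (jensen_pair i (j - i) ltac:(lia) ltac:(lia)) as H.
    simpl in H. replace (i + (j - i))%nat with j in H by lia.
    replace (v j - v i) with
      (rsum (j - i) (fun k => y (i + k)%nat * Rpower (ratio (i + k)%nat) (1 - m))).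
    - simpl. lra.
    - unfold v. replace j with (i + (j - i))%nat at 2 by lia. rewrite rsum_add. ring. }
  (* Every pair has a nonnegative defect; only the outermost pair is kept, since its variance
     involves all the gaps. *)
  eapply Rle_trans; [|apply (tri_term_le (S n) _ 0 n); [|lia|lia]].
  - pose proof (Hdef 0%nat n Hn ltac:(lia)) as H. rewrite Nat.sub_0_r in H. exact H.
  - intros i j Hij Hj. eapply Rle_trans; [|apply Hdef; auto].
    apply Rmult_le_pos; [left; apply Rpower_gt0|]. apply Rmult_le_pos; auto.
    apply rsum_nonneg. intros k Hk. specialize (Hy (i + k)%nat ltac:(lia)).
    apply Rmult_le_pos; [lra|apply pow2_ge_0].
Qed.

End Jensen.

(** The diameter bound [B] is what makes [C] independent of [Z]: the convexity of [x ^ (1 - m)]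
    degenerates for large ratios. *)
Lemma critical_rigidity n m chi Y B :
  1 < m -> 0 < chi -> (0 < n)%nat -> 0 < B -> ordered n Y ->
  (forall i, (i < S n)%nat -> flow_rhs (S n) m chi Y i = 0) ->
  exists C, 0 < C /\ forall Z k, ordered n Z -> Z n - Z 0%nat <= B -> (k < n)%nat ->
    (Z (k + 1)%nat - Z k - (Z n - Z 0%nat) / (Y n - Y 0%nat) * (Y (k + 1)%nat - Y k)) ^ 2
      <= C * energy n m chi Z.
Proof.
  intros Hm Hchi Hn HB HY Hcrit.
  (* No gap of [Z] exceeds [B], so each ratio is at most one term of this sum of positive terms. *)
  set (L := rsum n (fun k => B / (Y (k + 1)%nat - Y k))).
  set (D := Y n - Y 0%nat).
  assert (HD : 0 < D).
  { unfold D. pose proof (ordered_lt n Y 0 n HY ltac:(lia)). lra. }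
  set (c := 2 * chi * (Rpower D (- m) * (m * (m - 1) / 2 * Rpower L (- m - 1)))).
  assert (Hc : 0 < c).
  { unfold c. pose proof (Rpower_gt0 D (- m)). pose proof (Rpower_gt0 L (- m - 1)).
    repeat apply Rmult_lt_0_compat; lra. }
  exists (D / c). split; [now apply Rdiv_lt_0_compat|].
  intros Z k HZ HZB Hk.
  assert (HL : forall k, (k < n)%nat -> Z (k + 1)%nat - Z k <= L * (Y (k + 1)%nat - Y k)).
  { intros j Hj. pose proof (HY j Hj) as Hyj.
    assert (H1 : B / (Y (j + 1)%nat - Y j) <= L).
    { apply (rsum_term_le n (fun k => B / (Y (k + 1)%nat - Y k))); auto.
      intros i Hi. pose proof (HY i Hi). left. apply Rdiv_lt_0_compat; lra. }
    apply Rmult_le_compat_r with (r := Y (j + 1)%nat - Y j) in H1; [|lra].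
    replace (B / (Y (j + 1)%nat - Y j) * (Y (j + 1)%nat - Y j)) with B in H1 by (field; lra).
    pose proof (ordered_le n Z 0 j HZ ltac:(lia)).
    pose proof (ordered_le n Z (j + 1) n HZ ltac:(lia)). lra. }
  pose proof (energy_defect n m chi Y Z L Hm Hchi HY HZ HL Hn Hcrit) as H.
  cbv zeta in H. fold D in H. set (lam := (Z n - Z 0%nat) / D) in *.
  pose proof (rsum_term_le n (fun k => (Y (k + 1)%nat - Y k) *
    ((Z (k + 1)%nat - Z k) / (Y (k + 1)%nat - Y k) - lam) ^ 2) k) as Hterm.
  cbv beta in Hterm. set (S := rsum n (fun k => (Y (k + 1)%nat - Y k) *
    ((Z (k + 1)%nat - Z k) / (Y (k + 1)%nat - Y k) - lam) ^ 2)) in *.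
  assert (HS : c * S <= energy n m chi Z) by (unfold c; lra).
  set (yk := Y (k + 1)%nat - Y k) in *. set (zk := Z (k + 1)%nat - Z k) in *.
  assert (Hyk : 0 < yk <= D).
  { pose proof (HY k Hk). pose proof (ordered_le n Y 0 k HY ltac:(lia)).
    pose proof (ordered_le n Y (k + 1) n HY ltac:(lia)). unfold yk, D. lra. }
  assert (H1 : yk * (zk / yk - lam) ^ 2 <= S).
  { apply Hterm; auto. intros i Hi. pose proof (HY i Hi).
    apply Rmult_le_pos; [lra|apply pow2_ge_0]. }
  replace (zk - lam * yk) with (yk * (zk / yk - lam)) by (field; lra).
  assert (H2 : (yk * (zk / yk - lam)) ^ 2 <= D * S).
  { replace ((yk * (zk / yk - lam)) ^ 2) with (yk * (yk * (zk / yk - lam) ^ 2)) by ring.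
    assert (0 <= yk * (zk / yk - lam) ^ 2) by (apply Rmult_le_pos; [lra|apply pow2_ge_0]).
    apply Rmult_le_compat; auto; lra. }
  apply Rle_trans with (1 := H2).
  apply Rmult_le_compat_l with (r := D / c) in HS; [|left; now apply Rdiv_lt_0_compat].
  replace (D / c * (c * S)) with (D * S) in HS by (field; lra). exact HS.
Qed.

(** [(n + 1) * W i] is the sum of the differences [W i - W j], each a sum of at most [n] increments
    up to sign. *)
Lemma centered_small n W e : rsum (S n) W = 0 ->
  (forall k, (k < n)%nat -> Rabs (W (k + 1)%nat - W k) <= e) ->
  forall i, (i < S n)%nat -> Rabs (W i) <= INR n * e.
Proof.
  intros Hs He i Hi.
  assert (Hij : forall l a, (a + l < S n)%nat -> Rabs (W (a + l)%nat - W a) <= INR n * e).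
  { intros l a Hl. rewrite <- rsum_telescope.
    eapply Rle_trans; [apply rsum_Rabs|].
    apply Rle_trans with (INR l * e).
    - rewrite <- rsum_const. apply rsum_le. intros k Hk. apply He. lia.
    - destruct (Nat.eq_dec n 0) as [->|].
      { replace l with 0%nat by lia. simpl; lra. }
      pose proof (He 0%nat ltac:(lia)). pose proof (Rabs_pos (W (0 + 1)%nat - W 0%nat)).
      apply Rmult_le_compat_r; [lra|]. apply le_INR. lia. }
  assert (Hd : forall j, (j < S n)%nat -> Rabs (W i - W j) <= INR n * e).
  { intros j Hj. destruct (Nat.le_ge_cases i j).
    - rewrite Rabs_minus_sym. replace j with (i + (j - i))%nat by lia. apply Hij. lia.
    - replace i with (j + (i - j))%nat by lia. apply Hij. lia. }
  assert (HN : 0 < INR (S n)) by (apply lt_0_INR; lia).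
  apply Rmult_le_reg_l with (INR (S n)); auto.
  rewrite <- (Rabs_right (INR (S n))) at 1 by lra. rewrite <- Rabs_mult.
  replace (INR (S n) * W i) with (rsum (S n) (fun j => W i - W j)).
  - eapply Rle_trans; [apply rsum_Rabs|]. rewrite <- rsum_const. apply rsum_le. auto.
  - rewrite (rsum_minus (S n) (fun _ => W i) W), rsum_const, Hs. ring.
Qed.

(** * Energy estimates along the flow *)

Lemma inRN_ordered n X : inRN (S n) X -> ordered n X.
Proof. intros [H _] i Hi. apply H. lia. Qed.

(** The derivative is [-(m - 1)] times the squared velocity. Times start at [s > 0] because at 0 a
    solution is only assumed right-continuous. *)
Lemma solution_energy_le n m chi X0 T X s t : 1 < m ->
  is_solution (S n) m chi X0 T X -> 0 < s <= t -> Rbar_lt t T ->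
  energy n m chi (X t) <= energy n m chi (X s).
Proof.
  intros Hm [_ [_ [HRN [_ Hder]]]] Hst HtT.
  assert (HT : forall x, s <= x <= t -> Rbar_lt x T).
  { intros x Hx. apply Rbar_le_lt_trans with t; auto. simpl. lra. }
  destruct (mvt (fun x => energy n m chi (X x)) (fun x => - (m - 1) *
    rsum (S n) (fun i => flow_rhs (S n) m chi (X x) i * flow_rhs (S n) m chi (X x) i)) s t)
    as [c [Hc E]]; [lra| |].
  - intros x Hx. apply energy_derive.
    + apply inRN_ordered, HRN; [lra|auto].
    + intros i Hi. apply Hder; auto. lra.
  - pose proof (rsum_nonneg (S n)
      (fun i => flow_rhs (S n) m chi (X c) i * flow_rhs (S n) m chi (X c) i)
      ltac:(intros; nra)) as Hp.
    assert (0 <= (m - 1) * rsum (S n)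
      (fun i => flow_rhs (S n) m chi (X c) i * flow_rhs (S n) m chi (X c) i) * (t - s))
      by (repeat apply Rmult_le_pos; lra).
    lra.
Qed.

(** Kept with an intermediate time [c] because it is used both ways: nonnegative energy keeps the
    norm from decreasing, and a bounded norm forces the energy to be small at some time. *)
Lemma solution_norm n m chi X0 T X s t :
  is_solution (S n) m chi X0 T X -> 0 < s <= t -> Rbar_lt t T ->
  exists c, s <= c <= t /\
    rsum (S n) (fun i => X t i ^ 2) - rsum (S n) (fun i => X s i ^ 2)
      = 2 * energy n m chi (X c) * (t - s).
Proof.
  intros [_ [_ [HRN [_ Hder]]]] Hst HtT.
  assert (HT : forall x, s <= x <= t -> Rbar_lt x T).
  { intros x Hx. apply Rbar_le_lt_trans with t; auto. simpl. lra. }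
  apply (mvt (fun x => rsum (S n) (fun i => X x i ^ 2)) (fun x => 2 * energy n m chi (X x)));
    [lra|].
  intros x Hx. rewrite <- flow_euler by (apply inRN_ordered, HRN; [lra|auto]).
  rewrite <- rsum_scal. apply (rsum_derive (S n) (fun i x => X x i ^ 2)).
  intros i Hi. pose proof (Hder x i ltac:(lra) (HT x Hx) Hi) as Hd.
  apply is_derive_Reals. apply is_derive_Reals in Hd.
  replace (2 * (X x i * flow_rhs (S n) m chi (X x) i)) with
    (INR 2 * X x i ^ pred 2 * flow_rhs (S n) m chi (X x) i) by (simpl; ring).
  apply (derivable_pt_lim_comp (fun x => X x i) (fun z => z ^ 2)); auto.
  apply derivable_pt_lim_pow.
Qed.

(** A centered configuration has 0 between its extreme particles, so no coordinate exceeds the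
    diameter in modulus. *)
Lemma centered_diameter n X : inRN (S n) X ->
  rsum (S n) (fun i => X i ^ 2) <= INR (S n) * (X n - X 0%nat) ^ 2.
Proof.
  intros HX. pose proof (inRN_ordered n X HX) as Ho. destruct HX as [_ Hs].
  assert (HN : 0 < INR (S n)) by (apply lt_0_INR; lia).
  assert (H0 : X 0%nat <= 0).
  { apply Rmult_le_reg_l with (INR (S n)); auto. rewrite Rmult_0_r, <- Hs, <- rsum_const.
    apply rsum_le. intros i Hi. apply (ordered_le n X 0 i Ho). lia. }
  assert (Hn : 0 <= X n).
  { apply Rmult_le_reg_l with (INR (S n)); auto. rewrite Rmult_0_r, <- Hs, <- rsum_const.
    apply rsum_le. intros i Hi. apply (ordered_le n X i n Ho). lia. }
  rewrite <- rsum_const. apply rsum_le. intros i Hi.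
  pose proof (ordered_le n X 0 i Ho ltac:(lia)). pose proof (ordered_le n X i n Ho ltac:(lia)).
  nra.
Qed.

Lemma solution_diameter n m chi X0 T X t0 : (0 < n)%nat ->
  is_solution (S n) m chi X0 T X -> 0 < t0 -> Rbar_lt t0 T ->
  (forall Z, ordered n Z -> 0 <= energy n m chi Z) ->
  exists D0, 0 < D0 /\ forall t, t0 <= t -> Rbar_lt t T -> D0 <= X t n - X t 0%nat.
Proof.
  intros Hn Hsol Ht0 Ht0T Hpos. pose proof Hsol as [_ [_ [HRN _]]].
  set (q := rsum (S n) (fun i => X t0 i ^ 2)).
  assert (HN : 0 < INR (S n)) by (apply lt_0_INR; lia).
  assert (Hq : 0 < q).
  { pose proof (inRN_ordered n _ (HRN t0 ltac:(lra) Ht0T)) as Ho.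
    pose proof (ordered_lt n _ 0 n Ho ltac:(lia)).
    pose proof (rsum_term_le (S n) (fun i => X t0 i ^ 2) 0 ltac:(intros; apply pow2_ge_0)
      ltac:(lia)) as A1.
    pose proof (rsum_term_le (S n) (fun i => X t0 i ^ 2) n ltac:(intros; apply pow2_ge_0)
      ltac:(lia)) as A2. cbv beta in A1, A2. fold q in A1, A2.
    destruct (Req_dec (X t0 0%nat) 0) as [Hz|Hz].
    - pose proof (pow2_gt_0 (X t0 n) ltac:(lra)). lra.
    - pose proof (pow2_gt_0 _ Hz). lra. }
  assert (Hqn : 0 < q / INR (S n)) by now apply Rdiv_lt_0_compat.
  (* The squared norm does not fall below [q] and is at most [n + 1] times the squared diameter. *)
  exists (sqrt (q / INR (S n))). split; [now apply sqrt_lt_R0|].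
  intros t Ht HtT.
  destruct (solution_norm n m chi X0 T X t0 t Hsol ltac:(lra) HtT) as [c [Hc E]].
  assert (Hcpos : 0 <= energy n m chi (X c)).
  { apply Hpos, inRN_ordered, HRN; [lra|]. apply Rbar_le_lt_trans with t; auto. simpl; lra. }
  assert (Hinc : q <= rsum (S n) (fun i => X t i ^ 2)).
  { fold q in E. assert (0 <= 2 * energy n m chi (X c) * (t - t0)) by (repeat apply Rmult_le_pos; lra). lra. }
  pose proof (centered_diameter n (X t) (HRN t ltac:(lra) HtT)) as Hd.
  pose proof (ordered_lt n _ 0 n (inRN_ordered n _ (HRN t ltac:(lra) HtT)) ltac:(lia)).
  rewrite <- (sqrt_pow2 (X t n - X t 0%nat)) by lra.
  apply sqrt_le_1_alt. apply Rmult_le_reg_l with (INR (S n)); auto.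
  replace (INR (S n) * (q / INR (S n))) with q by (field; lra). lra.
Qed.

Lemma separated_of_gap_energy n m G : 1 < m -> 0 <= G ->
  exists d, 0 < d /\ forall X, ordered n X -> gap_energy n m X <= G -> separated n d X.
Proof.
  (* The length whose gap term is [G + 1]: a shorter gap would alone exceed the budget [G]. *)
  intros Hm HG. exists (Rpower (G + 1) (/ (1 - m))). split; [apply Rpower_gt0|].
  intros X HX HE k Hk. apply Rnot_lt_le. intros Hlt.
  assert (H0 : 0 < X (k + 1)%nat - X k) by (pose proof (HX k Hk); lra).
  pose proof (Rpower_decr (1 - m) (X (k + 1)%nat - X k) _ ltac:(lra)
    (conj H0 (Rlt_le _ _ Hlt))) as H1.
  rewrite Rpower_mult, Rinv_l, Rpower_1 in H1 by lra.
  pose proof (rsum_term_le n (fun k => Rpower (X (k + 1)%nat - X k) (1 - m)) k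
    ltac:(intros; left; apply Rpower_gt0) Hk) as H2. cbv beta in H2.
  unfold gap_energy in HE. lra.
Qed.

Lemma solution_separated n m chi X0 T X t0 : 1 < m -> 0 < chi ->
  is_solution (S (S n)) m chi X0 T X -> 0 < t0 -> Rbar_lt t0 T ->
  ratio_bound m (S n) (/ chi) ->
  (forall Z, ordered (S n) Z -> 0 <= energy (S n) m chi Z) ->
  exists d, 0 < d /\ forall t, t0 <= t -> Rbar_lt t T -> separated (S n) d (X t).
Proof.
  intros Hm Hchi Hsol Ht0 Ht0T Hrb Hpos. pose proof Hsol as [_ [_ [HRN _]]].
  destruct (solution_diameter (S n) m chi X0 T X t0 ltac:(lia) Hsol Ht0 Ht0T Hpos)
    as [D0 [HD0 Hdiam]].
  destruct (coercivity m n (/ chi) Hm Hrb) as [e [C [He [HC Hco]]]].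
  set (E0 := energy (S n) m chi (X t0)).
  assert (HE0 : 0 <= E0) by (apply Hpos, inRN_ordered, HRN; [lra|auto]).
  assert (HP : 0 < Rpower D0 (1 - m)) by apply Rpower_gt0.
  assert (Hci : 0 < / chi) by now apply Rinv_0_lt_compat.
  assert (HG : 0 <= / chi * E0 + C * Rpower D0 (1 - m)).
  { apply Rplus_le_le_0_compat; apply Rmult_le_pos; lra. }
  (* Coercivity at time [t], with energy at most [E0] and diameter at least [D0], bounds the gap
     energy by this value. *)
  destruct (separated_of_gap_energy (S n) m ((/ chi * E0 + C * Rpower D0 (1 - m)) / e) Hm)
    as [d [Hd Hsep]].
  { apply Rdiv_le_0_compat; lra. }
  exists d. split; auto. intros t Ht HtT.
  pose proof (inRN_ordered _ _ (HRN t ltac:(lra) HtT)) as Ho.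
  apply Hsep; auto. specialize (Hco _ Ho). specialize (Hdiam t Ht HtT).
  pose proof (Rpower_decr (1 - m) D0 (X t (S n) - X t 0%nat) ltac:(lra) ltac:(lra)) as H1.
  pose proof (solution_energy_le (S n) m chi X0 T X t0 t Hm Hsol ltac:(lra) HtT) as H2.
  fold E0 in H2.
  replace (/ chi * gap_energy (S n) m (X t) - 2 * tri_energy (S n) m (X t))
    with (/ chi * energy (S n) m chi (X t)) in Hco by (unfold energy; field; lra).
  apply Rmult_le_reg_l with e; auto.
  replace (e * ((/ chi * E0 + C * Rpower D0 (1 - m)) / e)) with
    (/ chi * E0 + C * Rpower D0 (1 - m)) by (field; lra).
  pose proof (Rmult_le_compat_l _ _ _ (Rlt_le _ _ HC) H1).
  pose proof (Rmult_le_compat_l _ _ _ (Rlt_le _ _ Hci) H2). lra.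
Qed.

(** * Euclidean norm and scaling *)

Lemma enorm_sq N X : rsum N (fun i => X i ^ 2) = enorm N X ^ 2.
Proof.
  unfold enorm. rewrite pow2_sqrt; auto. apply rsum_nonneg. intros; apply pow2_ge_0.
Qed.

Lemma enorm_nonneg N X : 0 <= enorm N X.
Proof. apply sqrt_pos. Qed.

Lemma enorm_coord N X i : (i < N)%nat -> Rabs (X i) <= enorm N X.
Proof.
  intros Hi. rewrite <- (sqrt_pow2 (Rabs (X i))) by apply Rabs_pos.
  apply sqrt_le_1_alt. rewrite pow2_abs.
  apply (rsum_term_le N (fun i => X i ^ 2)); auto. intros; apply pow2_ge_0.
Qed.

Lemma enorm_scal N c X : 0 <= c -> enorm N (fun i => c * X i) = c * enorm N X.
Proof.
  intros Hc. unfold enorm.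
  rewrite (rsum_ext N _ (fun i => c ^ 2 * X i ^ 2)) by (intros; ring).
  rewrite rsum_scal, sqrt_mult_alt by apply pow2_ge_0. now rewrite sqrt_pow2.
Qed.

Lemma enorm_ext N X Y : (forall i, (i < N)%nat -> X i = Y i) -> enorm N X = enorm N Y.
Proof.
  intros H. unfold enorm. f_equal. apply rsum_ext. intros i Hi. now rewrite H.
Qed.

Lemma enorm_is_lim N (U : R -> vec) (Y : vec) :
  (forall i, (i < N)%nat -> is_lim (fun t => U t i) p_infty (Y i)) ->
  is_lim (fun t => enorm N (U t)) p_infty (enorm N Y).
Proof.
  intros H.
  assert (Hs : is_lim (fun t => rsum N (fun i => U t i ^ 2)) p_infty
    (Finite (rsum N (fun i => Y i ^ 2)))).
  { induction N as [|N IH]; simpl rsum; [apply is_lim_const|].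
    apply is_lim_plus'; [apply IH; intros; apply H; lia|].
    apply is_lim_ext with (fun t => U t N * U t N); [intros; ring|].
    rewrite Rmult_1_r.
    apply (is_lim_mult (fun t => U t N) (fun t => U t N) p_infty (Y N) (Y N));
      [apply H; lia|apply H; lia|exact I]. }
  unfold enorm. unfold is_lim in *. eapply filterlim_comp; [apply Hs|].
  simpl Rbar_locally. apply continuous_sqrt.
Qed.

Lemma energy_scal n m chi c X : 0 < c -> ordered n X ->
  energy n m chi (fun i => c * X i) = Rpower c (1 - m) * energy n m chi X.
Proof.
  intros Hc HX. unfold energy, gap_energy, tri_energy.
  rewrite (rsum_ext n _ (fun k => Rpower c (1 - m) * Rpower (X (k + 1)%nat - X k) (1 - m))).
  2:{ intros k Hk. pose proof (HX k Hk). rewrite Rpower_mult_distr by lra. f_equal. ring. }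
  rewrite (tri_ext (S n) _ (fun i j => Rpower c (1 - m) * Rpower (X j - X i) (1 - m))).
  2:{ intros i j Hij Hj. pose proof (ordered_lt n X i j HX ltac:(lia)).
      rewrite Rpower_mult_distr by lra. f_equal. ring. }
  rewrite rsum_scal, tri_scal. ring.
Qed.

(** * Consequences of the sharp constant: uniqueness and convergence *)

Lemma is_CN_ratio_bound n m chi : is_CN (S (S n)) m chi -> ratio_bound m (S n) (/ chi).
Proof.
  intros [Hc [_ Hmax]] X HX.
  (* Both energies depend only on differences, so subtracting the mean reaches the centered
     configurations that [is_CN] tests. *)
  set (a := rsum (S (S n)) X / INR (S (S n))).
  assert (HN : 0 < INR (S (S n))) by (apply lt_0_INR; lia).
  set (Z := fun i => X i - a).
  assert (HZ : inRN (S (S n)) Z).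
  { split.
    - intros i Hi. unfold Z. pose proof (HX i ltac:(lia)). lra.
    - unfold Z. rewrite (rsum_minus _ X (fun _ => a)), rsum_const. unfold a. field. lra. }
  specialize (Hmax Z HZ).
  rewrite pair_sum_energy, near_sum_energy in Hmax by now apply inRN_ordered.
  assert (HT : tri_energy (S n) m Z = tri_energy (S n) m X).
  { apply tri_ext. intros. unfold Z. f_equal. ring. }
  assert (HG : gap_energy (S n) m Z = gap_energy (S n) m X).
  { apply rsum_ext. intros. unfold Z. f_equal. ring. }
  rewrite HT, HG in Hmax.
  assert (HGp : 0 < gap_energy (S n) m X).
  { eapply Rlt_le_trans; [|apply (rsum_term_le (S n) _ 0); [|lia]]; [apply Rpower_gt0|].
    intros; left; apply Rpower_gt0. }
  apply Rmult_le_compat_r with (r := gap_energy (S n) m X) in Hmax; [|lra].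
  unfold Rdiv in Hmax. rewrite Rmult_assoc, Rinv_l in Hmax by lra. lra.
Qed.

Lemma ratio_bound_energy_nonneg m n chi X : 0 < chi -> ratio_bound m n (/ chi) ->
  ordered n X -> 0 <= energy n m chi X.
Proof.
  intros Hc H HX. specialize (H X HX). apply Rmult_le_compat_l with (r := chi) in H; [|lra].
  replace (chi * (/ chi * gap_energy n m X)) with (gap_energy n m X) in H by (field; lra).
  unfold energy. lra.
Qed.

(** Zero energy of [Z] turns rigidity into equality: the gaps of [Z] are proportional to those of
    [Y]. Centering extends this to the coordinates, and the unit norms fix the factor. *)
Lemma critical_unique n m chi Y Z : 1 < m -> 0 < chi -> (0 < n)%nat ->
  inRN (S n) Y -> enorm (S n) Y = 1 ->
  (forall i, (i < S n)%nat -> flow_rhs (S n) m chi Y i = 0) ->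
  inRN (S n) Z -> enorm (S n) Z = 1 -> energy n m chi Z = 0 ->
  forall i, (i < S n)%nat -> Z i = Y i.
Proof.
  intros Hm Hchi Hn HY HY1 Hcrit HZ HZ1 HE.
  pose proof (inRN_ordered _ _ HY) as HoY. pose proof (inRN_ordered _ _ HZ) as HoZ.
  pose proof (ordered_lt n Y 0 n HoY ltac:(lia)). pose proof (ordered_lt n Z 0 n HoZ ltac:(lia)).
  destruct (critical_rigidity n m chi Y (Z n - Z 0%nat) Hm Hchi Hn ltac:(lra) HoY Hcrit)
    as [C [HC Hr]].
  set (lam := (Z n - Z 0%nat) / (Y n - Y 0%nat)) in *.
  assert (Hlam : 0 < lam) by (apply Rdiv_lt_0_compat; lra).
  assert (Heq : forall i, (i < S n)%nat -> Z i = lam * Y i).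
  { intros i Hi.
    assert (Hs : Rabs (Z i - lam * Y i) <= INR n * 0).
    { apply (centered_small n (fun i => Z i - lam * Y i)); auto.
      - rewrite (rsum_minus (S n) Z (fun i => lam * Y i)), rsum_scal.
        destruct HY as [_ ->]. destruct HZ as [_ ->]. ring.
      - intros k Hk. specialize (Hr Z k HoZ (Rle_refl _) Hk). rewrite HE, Rmult_0_r in Hr.
        fold lam in Hr. rewrite <- Rabs_R0. right. f_equal.
        set (w := Z (k + 1)%nat - Z k - lam * (Y (k + 1)%nat - Y k)) in *.
        assert (Hw : w = 0).
        { destruct (Req_dec w 0) as [|Hw]; [auto|pose proof (pow2_gt_0 w Hw); lra]. }
        unfold w in Hw. lra. }
    rewrite Rmult_0_r in Hs. pose proof (Rabs_pos (Z i - lam * Y i)).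
    assert (Z i - lam * Y i = 0) by (apply Rabs_eq_0; lra). lra. }
  rewrite (enorm_ext _ _ _ Heq), enorm_scal, HY1 in HZ1 by lra.
  intros i Hi. rewrite Heq by auto. replace lam with 1 by lra. ring.
Qed.

Lemma solution_energy_small n m chi X0 X B eta : 1 < m ->
  is_solution (S n) m chi X0 p_infty X -> (forall t, 0 <= t -> enorm (S n) (X t) <= B) ->
  0 < eta -> exists t1, 1 <= t1 /\ forall t, t1 <= t -> energy n m chi (X t) <= eta.
Proof.
  intros Hm Hsol HB Heta.
  assert (HB0 : 0 <= B ^ 2) by apply pow2_ge_0.
  (* Between times 1 and [t1] an energy above [eta] throughout would raise the squared norm by more
     than [B ^ 2]. *)
  set (t1 := 1 + (B ^ 2 + 1) / (2 * eta)).
  assert (Ht1 : 0 < (B ^ 2 + 1) / (2 * eta)) by (apply Rdiv_lt_0_compat; lra).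
  destruct (solution_norm n m chi X0 p_infty X 1 t1 Hsol ltac:(unfold t1; lra) I)
    as [c [Hc E]].
  exists t1. split; [unfold t1; lra|]. intros t Ht.
  apply Rle_trans with (energy n m chi (X c)).
  { apply (solution_energy_le n m chi X0 p_infty X c t); auto; [lra|exact I]. }
  apply Rnot_lt_le. intros Hlt. rewrite !enorm_sq in E.
  pose proof (pow2_ge_0 (enorm (S n) (X 1))).
  pose proof (pow_incr (enorm (S n) (X t1)) B 2
    (conj (enorm_nonneg _ _) (HB t1 ltac:(unfold t1; lra)))).
  assert (2 * eta * (t1 - 1) = B ^ 2 + 1) by (unfold t1; field; lra).
  assert (2 * eta * (t1 - 1) <= 2 * energy n m chi (X c) * (t1 - 1)).
  { apply Rmult_le_compat_r; unfold t1; lra. }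
  lra.
Qed.

(** Rescaling by the diameter ratio [lam] comes first, as rigidity is expressed with it; since
    [X / |X|] is invariant under scaling, the normalized limit follows by continuity of the norm. *)
Lemma solution_converges n m chi X0 X B Y : 1 < m -> 0 < chi -> (0 < n)%nat ->
  is_solution (S n) m chi X0 p_infty X -> (forall t, 0 <= t -> enorm (S n) (X t) <= B) ->
  (forall Z, ordered n Z -> 0 <= energy n m chi Z) ->
  inRN (S n) Y -> enorm (S n) Y = 1 ->
  (forall i, (i < S n)%nat -> flow_rhs (S n) m chi Y i = 0) ->
  forall i, (i < S n)%nat -> is_lim (fun t => X t i / enorm (S n) (X t)) p_infty (Y i).
Proof.
  intros Hm Hchi Hn Hsol HB Hpos HY HY1 Hcrit. pose proof Hsol as [_ [_ [HRN _]]].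
  pose proof (inRN_ordered _ _ HY) as HoY. pose proof (ordered_lt n Y 0 n HoY ltac:(lia)) as HYn.
  destruct (solution_diameter n m chi X0 p_infty X 1 Hn Hsol ltac:(lra) I Hpos)
    as [D0 [HD0 Hdiam]].
  assert (HB0 : 0 <= B) by (apply Rle_trans with (enorm (S n) (X 1)); [apply enorm_nonneg|apply HB; lra]).
  (* The diameter is at most [2 * B]; adding 1 keeps the bound positive. *)
  destruct (critical_rigidity n m chi Y (2 * B + 1) Hm Hchi Hn ltac:(lra) HoY Hcrit)
    as [C [HC Hr]].
  set (lam := fun t => (X t n - X t 0%nat) / (Y n - Y 0%nat)).
  set (l0 := D0 / (Y n - Y 0%nat)).
  assert (Hl0 : 0 < l0) by (apply Rdiv_lt_0_compat; lra).
  assert (Hlam : forall t, 1 <= t -> l0 <= lam t).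
  { intros t Ht. apply Rmult_le_compat_r; [|apply Hdiam; [lra|exact I]].
    left. apply Rinv_0_lt_compat. lra. }
  assert (HnR : 0 < INR n) by (apply lt_0_INR; lia).
  assert (Hlim : forall i, (i < S n)%nat -> is_lim (fun t => / lam t * X t i) p_infty (Y i)).
  { intros i Hi. apply is_lim_spec. intros eps. pose proof (cond_pos eps) as Heps.
    (* An error [e] in each gap gives at most [INR n * e = l0 * eps / 2] in each coordinate, and
       division by [lam t >= l0] leaves at most [eps / 2]. *)
    set (e := l0 * (eps / (2 * INR n))).
    assert (He : 0 < e).
    { apply Rmult_lt_0_compat; auto. apply Rdiv_lt_0_compat; lra. }
    destruct (solution_energy_small n m chi X0 X B (e ^ 2 / C) Hm Hsol HB) as [t1 [Ht1 Hsm]].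
    { apply Rdiv_lt_0_compat; auto. apply pow_lt. auto. }
    exists t1. intros t Ht.
    pose proof (HRN t ltac:(lra) I) as HXt. pose proof (inRN_ordered _ _ HXt) as HoX.
    specialize (Hlam t ltac:(lra)).
    assert (HW : Rabs (X t i - lam t * Y i) <= INR n * e).
    { apply (centered_small n (fun i => X t i - lam t * Y i)); auto.
      - rewrite (rsum_minus (S n) (X t) (fun i => lam t * Y i)), rsum_scal.
        destruct HY as [_ ->]. destruct HXt as [_ ->]. ring.
      - intros k Hk.
        assert (HXB : X t n - X t 0%nat <= 2 * B + 1).
        { pose proof (enorm_coord (S n) (X t) 0 ltac:(lia)) as A1.
          pose proof (enorm_coord (S n) (X t) n ltac:(lia)) as A2.
          pose proof (HB t ltac:(lra)).
          apply Rabs_le_between in A1. apply Rabs_le_between in A2. lra. }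
        specialize (Hr (X t) k HoX HXB Hk). fold (lam t) in Hr.
        specialize (Hsm t ltac:(lra)).
        apply Rmult_le_compat_l with (r := C) in Hsm; [|lra].
        replace (C * (e ^ 2 / C)) with (e ^ 2) in Hsm by (field; lra).
        replace (X t (k + 1)%nat - lam t * Y (k + 1)%nat - (X t k - lam t * Y k)) with
          (X t (k + 1)%nat - X t k - lam t * (Y (k + 1)%nat - Y k)) by ring.
        rewrite <- (Rabs_right e) by lra.
        apply Rsqr_le_abs_0. unfold Rsqr. nra. }
    replace (/ lam t * X t i - Y i) with (/ lam t * (X t i - lam t * Y i)) by (field; lra).
    rewrite Rabs_mult, Rabs_inv, (Rabs_right (lam t)) by lra.
    apply Rmult_lt_reg_l with (lam t); [lra|].
    rewrite <- Rmult_assoc, Rinv_r, Rmult_1_l by lra.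
    apply Rle_lt_trans with (1 := HW).
    replace (INR n * e) with (l0 * (eps / 2)) by (unfold e; field; lra). nra. }
  intros i Hi.
  apply is_lim_ext_loc with (fun t => (/ lam t * X t i) / enorm (S n) (fun i => / lam t * X t i)).
  - exists 1. intros t Ht. specialize (Hlam t ltac:(lra)).
    assert (0 < / lam t) by (apply Rinv_0_lt_compat; lra).
    rewrite enorm_scal by lra.
    assert (0 < enorm (S n) (X t)).
    { specialize (Hdiam t ltac:(lra) I).
      pose proof (enorm_coord (S n) (X t) 0 ltac:(lia)) as A1.
      pose proof (enorm_coord (S n) (X t) n ltac:(lia)) as A2.
      apply Rabs_le_between in A1. apply Rabs_le_between in A2. lra. }
    field. split; lra.
  - replace (Finite (Y i)) with (Rbar_div (Y i) (enorm (S n) Y)).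
    + apply (is_lim_div (fun t => / lam t * X t i)
        (fun t => enorm (S n) (fun i => / lam t * X t i))); auto.
      * apply (enorm_is_lim (S n) (fun t i => / lam t * X t i)). auto.
      * rewrite HY1. intros Hz. injection Hz. lra.
      * rewrite HY1. simpl. destruct (Req_dec_T 1 0); [lra|exact I].
    + rewrite HY1. simpl. f_equal. field.
Qed.

Theorem theorem1p5 (m : R) (N : nat) (chi : R) (X0 : vec) (T : Rbar) (X : R -> vec) :
  1 < m -> (2 <= N)%nat -> is_CN N m chi ->
  inRN N X0 ->
  is_maximal_solution N m chi X0 T X ->
  T = p_infty /\
  ((exists B : R, forall t, 0 <= t -> enorm N (X t) <= B) ->
   exists Ystar : vec,
     (inRN N Ystar /\ enorm N Ystar = 1 /\ is_critical N m chi Ystar) /\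
     (forall Z : vec, inRN N Z -> enorm N Z = 1 -> is_critical N m chi Z ->
        forall i, (i < N)%nat -> Z i = Ystar i) /\
     (forall i, (i < N)%nat ->
        is_lim (fun t => X t i / enorm N (X t)) p_infty (Ystar i))).
Proof.
  intros Hm HN HCN _ [Hsol Hmax].
  destruct N as [|[|n]]; [lia|lia|]. clear HN.
  pose proof (is_CN_ratio_bound n m chi HCN) as Hrb.
  destruct HCN as [Hchi [[Ym [HYm HYmr]] _]].
  assert (Hpos : forall Z, ordered (S n) Z -> 0 <= energy (S n) m chi Z).
  { intros Z. now apply ratio_bound_energy_nonneg. }
  assert (HT : T = p_infty).
  { pose proof Hsol as [HT0 _]. destruct T as [T| |]; [|auto|destruct HT0].
    exfalso. simpl in HT0. apply Hmax.
    (* Any time strictly between 0 and [T] would do; 0 is excluded for lack of a derivative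
       there. *)
    destruct (solution_separated n m chi X0 T X (T / 2) Hm Hchi Hsol ltac:(lra)
      ltac:(simpl; lra) Hrb Hpos) as [d [Hd Hsep]].
    apply (extend_solution (S n) m chi X0 T X (T / 2) d); auto; try lra.
    intros t Ht. apply Hsep; [lra|simpl; lra]. }
  split; auto. subst T. clear Hmax. intros [B HB].
  pose proof (inRN_ordered _ _ HYm) as HoYm.
  (* Attaining the ratio [/ chi] means zero energy, which is the minimum; the scaling to unit norm
     below preserves this. *)
  assert (HEm : energy (S n) m chi Ym = 0).
  { rewrite pair_sum_energy, near_sum_energy in HYmr by auto.
    assert (HGp : 0 < gap_energy (S n) m Ym).
    { eapply Rlt_le_trans; [|apply (rsum_term_le (S n) _ 0); [|lia]]; [apply Rpower_gt0|].
      intros; left; apply Rpower_gt0. }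
    unfold energy. replace (2 * chi * tri_energy (S n) m Ym) with
      (chi * (2 * tri_energy (S n) m Ym / gap_energy (S n) m Ym) * gap_energy (S n) m Ym)
      by (field; lra).
    rewrite HYmr. field. lra. }
  assert (Hnorm : 0 < enorm (S (S n)) Ym).
  { pose proof (ordered_lt (S n) Ym 0 (S n) HoYm ltac:(lia)).
    pose proof (enorm_coord (S (S n)) Ym 0 ltac:(lia)) as A1.
    pose proof (enorm_coord (S (S n)) Ym (S n) ltac:(lia)) as A2.
    apply Rabs_le_between in A1. apply Rabs_le_between in A2. lra. }
  set (c := / enorm (S (S n)) Ym). assert (Hc : 0 < c) by now apply Rinv_0_lt_compat.
  set (Y := fun i => c * Ym i).
  assert (HY : inRN (S (S n)) Y).
  { destruct HYm as [H1 H2]. split.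
    - intros i Hi. apply Rmult_lt_compat_l; auto.
    - unfold Y. rewrite rsum_scal, H2. ring. }
  assert (HY1 : enorm (S (S n)) Y = 1).
  { unfold Y. rewrite enorm_scal by lra. unfold c. field. lra. }
  assert (Hcrit : forall i, (i < S (S n))%nat -> flow_rhs (S (S n)) m chi Y i = 0).
  { apply minimizer_critical; auto; [now apply inRN_ordered|].
    unfold Y. rewrite energy_scal, HEm by auto. ring. }
  exists Y. split; [|split].
  - split; [auto|split; auto]. apply critical_iff; auto. now apply inRN_ordered.
  - intros Z HZ HZ1 HZc. apply (critical_unique (S n) m chi Y Z); auto; [lia|].
    pose proof (inRN_ordered _ _ HZ) as HoZ.
    rewrite critical_iff in HZc by auto.
    (* By Euler's identity a critical [Z] has zero energy. *)
    rewrite <- flow_euler by auto.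
    rewrite (rsum_ext _ _ (fun _ => 0)) by (intros i Hi; rewrite HZc by auto; ring).
    rewrite rsum_const. ring.
  - apply (solution_converges (S n) m chi X0 X B Y); auto. lia.
Qed.
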